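(* Let $n \geq 3$ and let $\mathcal{K}$ be a finite dually bipartite chiral $n$-polytope with regular facets. Let $s \in \mathbb{N}$ (a positive integer). Then there exists a finite chiral extension $\mathcal{P}$ of $\mathcal{K}$ such that, if $\mathcal{P}$ is of type $\{p_1,\dots,p_{n-1},p_n\}$, then $2s \mid p_n$.
   Context: An (abstract) $n$-polytope is a partially ordered set $\mathcal{P}$ (whose elements are called faces) such that: (1) $\mathcal{P}$ has a minimum and a maximum; (2) every maximal chain (flag) has exactly $n+2$ elements, which gives a rank function onto $\{-1,\dots,n\}$; (3) (diamond condition) if $F<G$ have ranks $i-1$ and $i+1$, with $0\le i\le n-1$, there are exactly two faces $H$ with $F<H<G$; (4) (strong flag connectivity) any two flags $\Phi,\Psi$ are joined by a sequence of flags, all containing $\Phi\cap\Psi$, consecutive ones being adjacent. By (3), for each flag $\Phi$ and each $0\le i\le n-1$ there is a unique flag $\Phi^i\neq\Phi$ differing from $\Phi$ exactly in the face of rank $i$ ($\Phi$ and $\Phi^i$ are adjacent). Faces of rank $n-1$ are facets; a face $F$ is identified with the section $F/F_{-1}=\{H: H\le F\}$, where $F_{-1}$ is the minimum, so a facet is an $(n-1)$-polytope. $\mathrm{Aut}(\mathcal{P})$ is the group of order-preserving bijections (with order-preserving inverse) of $\mathcal{P}$; it acts freely on flags. $\mathcal{P}$ is regular if $\mathrm{Aut}(\mathcal{P})$ is transitive on flags. $\mathcal{P}$ is chiral if $\mathrm{Aut}(\mathcal{P})$ has exactly two orbits on flags and adjacent flags always lie in different orbits. $\mathcal{P}$ is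 of type (has Schläfli symbol) $\{p_1,\dots,p_{n-1}\}$ if for every $i\in\{1,\dots,n-1\}$ and all incident faces $F<G$ of ranks $i-2$ and $i+1$, the section $G/F=\{H:F\le H\le G\}$ is the face poset of a $p_i$-gon ($p_i\in\{2,\dots,\infty\}$), with $p_i$ depending only on $i$. Regular and chiral polytopes have a well-defined type. An $(n+1)$-polytope $\mathcal{P}$ is an extension of an $n$-polytope $\mathcal{K}$ if all facets of $\mathcal{P}$ are isomorphic to $\mathcal{K}$; it is a chiral extension if moreover $\mathcal{P}$ is chiral. An $n$-polytope is dually bipartite if its facets can be coloured with two colours so that two distinct facets incident to a common $(n-2)$-face have different colours. *)

(* Defs.v *)
From HB Require Import structures.
From mathcomp Require Import all_boot all_order all_algebra all_fingroup.

Set Implicit Arguments.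
Unset Strict Implicit.
Unset Printing Implicit Defensive.

Import Order.TTheory GroupScope.
Local Open Scope order_scope.

(* Only finite polytopes are needed, so a polytope is a [finPOrderType]; its  *)
(* elements are the faces. Ranks are integers, as they start at -1.           *)

Section Sections.
Context {d : Order.disp_t} {T : finPOrderType d}.

(* The sections G/F and F/F_{-1} (where F_{-1} is the minimum), as posets. *)
Definition section (F G : T) : Type := {H : T | F <= H <= G}.
HB.instance Definition _ F G := Finite.on (section F G).
HB.instance Definition _ F G := SubType.on (section F G).
HB.instance Definition _ F G :=
  [SubChoice_isSubPOrder of section F G by <: with d].

Definition face_section (F : T) : Type := {H : T | H <= F}.
HB.instance Definition _ F := Finite.on (face_section F).
HB.instance Definition _ F := SubType.on (face_section F).
HB.instance Definition _ F :=
  [SubChoice_isSubPOrder of face_section F by <: with d].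
End Sections.

Section Polytope.
Context {d : Order.disp_t} (T : finPOrderType d).
Implicit Types (F G H : T) (A B Phi Psi : {set T}).

Definition chain A : bool := [forall F in A, forall G in A, F >=< G].

Definition flag A : bool := maxset chain A.

Definition flags : {set {set T}} := [set Phi | flag Phi].

(* When all flags have the same size, the largest chains of faces below F are *)
(* the sets of faces below F in the flags through F, so this is the usual     *)
(* rank function, with value -1 at the minimum.                               *)
Definition rank F : int :=
  ((\max_(A : {set T} | chain A && (A \subset [set H | (H < F)%O])) #|A|)%:Z
   - 1)%R.

Definition adjacent Phi Psi : bool :=
  [&& flag Phi, flag Psi, #|Phi :\: Psi| == 1%N & #|Psi :\: Phi| == 1%N].

Definition adjacent_through A : rel {set T} :=
  fun Phi Psi => [&& A \subset Phi, A \subset Psi & adjacent Phi Psi].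

Record is_polytope (n : nat) : Prop := IsPolytope {
  polytope_min : exists F, forall G, F <= G;
  polytope_max : exists F, forall G, G <= F;
  polytope_card_flag : forall Phi, flag Phi -> #|Phi| = n.+2;
  polytope_diamond : forall (i : nat) F G, (i < n)%N -> F < G ->
    rank F = (i%:Z - 1)%R -> rank G = (i%:Z + 1)%R ->
    #|[set H | (F < H < G)%O]| = 2;
  polytope_connected : forall Phi Psi, flag Phi -> flag Psi ->
    connect (adjacent_through (Phi :&: Psi)) Phi Psi
}.

Definition facet (n : nat) F : Prop := rank F = (n%:Z - 1)%R.

Definition poset_aut : {set {perm T}} :=
  [set f : {perm T} | [forall F, forall G, (f F <= f G)%O == (F <= G)%O]].

Lemma poset_aut_group_set : group_set poset_aut.
Proof.
apply/group_setP; split=> [|f g].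
  by rewrite inE; apply/forallP=> F; apply/forallP=> G; rewrite !perm1.
rewrite !inE => /forallP fP /forallP gP.
apply/forallP=> F; apply/forallP=> G; rewrite !permM.
by rewrite (eqP (forallP (gP _) _)) (eqP (forallP (fP _) _)).
Qed.
Canonical poset_aut_group := group poset_aut_group_set.

(* ['P^*] is the action of permutations of T on sets of elements of T. *)
Definition is_regular : Prop := [transitive poset_aut, on flags | 'P^*].

Definition is_chiral : Prop :=
  #|orbit 'P^* poset_aut @: flags| = 2 /\
  forall Phi Psi, adjacent Phi Psi ->
    orbit 'P^* poset_aut Phi != orbit 'P^* poset_aut Psi.

Definition dually_bipartite (n : nat) : Prop :=
  exists c : T -> bool, forall F G H,
    facet n F -> facet n G -> F != G ->
    rank H = (n%:Z - 2)%R -> H <= F -> H <= G -> c F != c G.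

End Polytope.

Definition rel_isomorphic (S T : Type) (r : rel S) (r' : rel T) : Prop :=
  exists2 f : S -> T, bijective f & forall x y, r' (f x) (f y) = r x y.

Definition isomorphic d d' (S : finPOrderType d) (T : finPOrderType d') :=
  rel_isomorphic (<=%O : rel S) (<=%O : rel T).

Inductive polygon_face (p : nat) : Type :=
  | PolygonMin
  | PolygonVertex of 'I_p
  | PolygonEdge of 'I_p
  | PolygonMax.

(* Edge j joins the vertices j and j + 1 (mod p). *)
Definition polygon_le (p : nat) : rel (polygon_face p) := fun x y =>
  match x, y with
  | PolygonMin, _ | _, PolygonMax => true
  | PolygonVertex i, PolygonVertex j => i == j
  | PolygonVertex i, PolygonEdge j => (i == j) || (i == ordS j)
  | PolygonEdge i, PolygonEdge j => i == j
  | _, _ => false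
  end.

(* The entry p_i of the Schlaefli symbol is [p i] for 1 <= i <= n - 1; other  *)
(* values of p are irrelevant. Sections of a finite polytope are finite, so   *)
(* the value p_i = oo cannot occur.                                           *)
Definition has_type d (T : finPOrderType d) (n : nat) (p : nat -> nat) : Prop :=
  forall i : nat, (0 < i < n)%N ->
    (2 <= p i)%N /\
    forall F G : T, F <= G ->
      rank F = (i%:Z - 2)%R -> rank G = (i%:Z + 1)%R ->
      rel_isomorphic (<=%O : rel (section F G)) (@polygon_le (p i)).

(* T is an (n+1)-polytope and K an n-polytope. *)
Definition is_extension d d' (T : finPOrderType d) (K : finPOrderType d')
    (n : nat) : Prop :=
  is_polytope T n.+1 /\
  forall F : T, facet n.+1 F -> isomorphic (face_section F) K.

(* Main.v *)
(** The flags of the extension are obtained from copies of the flag graph of K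
    glued along facets. Since K is chiral, crossing a facet F into the next
    copy has to reverse the orientation, and since F is regular this can be
    done by a reflection of F. For each k < n take 2s copies in a cycle, where
    a facet of copy j is glued to copy j + 1 or j - 1 according to its colour
    and the parity of j, and choose the reflections of the facets through the
    (k-1)-face of a fixed flag Phi0 so that they exchange the faces of rank <
    k of Phi0 with those of a neighbour Phi0^i. Thus a path from Phi0 which
    uses only colours >= k can come back to its copy only at a flag with the
    same faces of rank < k. The cover, whose flags are the words in the
    adjacencies modulo those fixing all white flags of all the copies, then
    satisfies the path intersection property, hence is the flag graph of a
    polytope P. Its two orbits are those of the white and black flags; an
    automorphism mixing them would restrict to a facet and contradict the
    chirality of K. Around an (n-2)-face of P the facets alternate in colour,
    so the copy index keeps moving in the same direction and p_n is a multiple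
    of the length 2s of the cycle. *)

From HB Require Import structures.
Require Import Defs.
From mathcomp Require Import all_boot all_order all_algebra all_fingroup.
From mathcomp Require Import zify.

Set Implicit Arguments.
Unset Strict Implicit.
Unset Printing Implicit Defensive.

Import Order.TTheory GroupScope.
Local Open Scope order_scope.

(** * Walks in edge-coloured graphs *)

Section Walks.
Context (X : finType) (r : nat -> X -> X) (N : nat).
Implicit Types (x y z : X) (p q : pred nat) (u v : seq nat).

Definition walk x u := foldl (fun y l => r l y) x u.

Definition step p : rel X :=
  fun x y => [exists l : 'I_N, p l && (r l x == y)].

Definition con p x y := connect (step p) x y.

Definition word p u := all (fun l => (l < N)%N && p l) u.

Lemma walk_cat x u v : walk x (u ++ v) = walk (walk x u) v.
Proof. exact: foldl_cat. Qed.

Lemma word_cat p u v : word p (u ++ v) = word p u && word p v.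
Proof. exact: all_cat. Qed.

Lemma word_sub p q u : {subset p <= q} -> word p u -> word q u.
Proof.
by move=> pq; apply: sub_all => l /andP[-> /pq].
Qed.

Lemma con_refl p x : con p x x. Proof. exact: connect0. Qed.

Lemma con_trans p y x z : con p x y -> con p y z -> con p x z.
Proof. exact: connect_trans. Qed.

Lemma conP p x y : reflect (exists2 u, word p u & walk x u = y) (con p x y).
Proof.
apply: (iffP idP) => [/connectP[s] | [u + <-]].
  elim: s x => [|z s IHs] x /= => [_ ->|/andP[/existsP[l /andP[pl /eqP<-]]]].
    by exists [::].
  move=> /IHs/[apply] -[u wu <-]; exists (nat_of_ord l :: u) => //=.
  by rewrite ltn_ord pl.
elim: u x => [|l u IHu] x /=; first by rewrite /con connect0.
move=> /andP[/andP[lN pl] /(IHu (r l x))]; apply: con_trans; apply: connect1.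
by apply/existsP; exists (Ordinal lN); rewrite pl /=.
Qed.

Lemma con_sub p q x y :
  (forall l, (l < N)%N -> p l -> q l) -> con p x y -> con q x y.
Proof.
move=> pq; apply: connect_sub => a b /existsP[l /andP[pl /eqP<-]].
by apply/connect1/existsP; exists l; rewrite pq ?eqxx.
Qed.

Lemma con_r p l x : (l < N)%N -> p l -> con p x (r l x).
Proof.
by move=> lN pl; apply/connect1/existsP; exists (Ordinal lN); rewrite pl /=.
Qed.

Lemma con_ind p (Q : X -> Prop) x y :
  (forall z l, (l < N)%N -> p l -> Q z -> Q (r l z)) ->
  Q x -> con p x y -> Q y.
Proof.
move=> Qr Qx /conP[u + <-]; elim: u x Qx => //= l u IHu x Qx.
by case/andP=> /andP[lN pl]; apply: IHu; apply: Qr.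
Qed.

Hypothesis rK : forall l, (l < N)%N -> involutive (r l).

Lemma con_symW p x y : con p x y -> con p y x.
Proof.
apply: (@con_ind p (fun z => con p z x)); last exact: con_refl.
move=> z l lN pl; apply: con_trans.
by rewrite -{2}[z](rK lN); apply: con_r.
Qed.

Lemma walk_rev u x : word predT u -> walk (walk x u) (rev u) = x.
Proof.
elim: u x => //= l u IHu x /andP[/andP[lN _] wu].
by rewrite rev_cons -cats1 walk_cat IHu //= rK.
Qed.

Lemma word_rev p u : word p (rev u) = word p u.
Proof. exact: all_rev. Qed.

End Walks.

(** * Order isomorphisms from a common indexing *)

Section OrderIndexing.
Context (I : Type) d d' (S : finPOrderType d) (T : finPOrderType d').

(** By antisymmetry [f] and [g] identify the same indices of [D], so [g] after a section of [f] is
    well defined. It is used with pairs of a height and a word as indices, for automorphisms and for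
    the facets of the extension. *)
Lemma indexed_iso (D : I -> Prop) (f : I -> S) (g : I -> T) :
  (forall x, exists2 i, D i & f i = x) -> (forall y, exists2 i, D i & g i = y) ->
  (forall i j, D i -> D j -> (f i <= f j) = (g i <= g j)) ->
  exists h : S -> T, [/\ bijective h, forall x y, (h x <= h y) = (x <= y)
    & forall i, D i -> h (f i) = g i].
Proof.
move=> fS gT fg.
have [a aP] : exists a : S -> I, forall x, D (a x) /\ f (a x) = x.
  have [F FP] := @fin_all_exists S (fun=> I) (fun x i => D i /\ f i = x)
    (fun x => let: ex_intro2 i Di e := fS x in ex_intro _ i (conj Di e)).
  by exists F.
have [b bP] : exists b : T -> I, forall x, D (b x) /\ g (b x) = x.
  have [F FP] := @fin_all_exists T (fun=> I) (fun x i => D i /\ g i = x)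
    (fun x => let: ex_intro2 i Di e := gT x in ex_intro _ i (conj Di e)).
  by exists F.
have fg_eq i j : D i -> D j -> f i = f j <-> g i = g j.
  by move=> Di Dj; split=> e; apply/le_anti; [rewrite -!fg | rewrite !fg];
    rewrite // e lexx.
have hf i : D i -> g (a (f i)) = g i.
  by move=> Di; apply/fg_eq => //; case: (aP (f i)).
exists (g \o a); split=> //=.
- exists (f \o b) => x /=.
    have [Da {2}<-] := aP x; have [Db] := bP (g (a x)).
    by move/(fg_eq _ _ Db Da).
  by have [Db {2}<-] := bP x; rewrite hf.
- by move=> x y; have [Dx {2}<-] := aP x; have [Dy {2}<-] := aP y; rewrite fg.
Qed.

End OrderIndexing.

(** Serves both the diamond condition, with two faces in each gap, and chirality, with two orbits of
    flags. *)
Lemma two_values (S : finType) (x y a b c : S) : b <> a -> c <> a ->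
  a \in [set x; y] -> b \in [set x; y] -> c \in [set x; y] -> b = c.
Proof.
by move=> + + /set2P A /set2P B /set2P C; case: A B C => -> [] -> [] ->.
Qed.

(** * Chains, flags and heights *)

Section Height.
Context d (T : finPOrderType d).
Implicit Types (F G H : T) (A B : {set T}).

(** The rank shifted by one, so as to stay in [nat]: in an n-polytope the minimum has height 0,
    facets have height n and the maximum has height n + 1. *)
Definition height F : nat :=
  \max_(A : {set T} | chain A && (A \subset [set H | (H < F)%O])) #|A|.

Lemma rank_height F (k : nat) : (rank F = k%:Z - 1 <-> height F = k)%R.
Proof. rewrite /rank -/(height F); lia. Qed.

Lemma chainP A : reflect {in A &, forall F G, F >=< G} (chain A).
Proof.
apply: (iffP forall_inP) => [cA F G FA GA | cA F FA].
  by have /forall_inP := cA _ FA; apply.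
by apply/forall_inP => G GA; apply: cA.
Qed.

Lemma chain_sub A B : A \subset B -> chain B -> chain A.
Proof.
by move=> /subsetP AB /chainP cB; apply/chainP => F G /AB FB /AB; apply: cB.
Qed.

Lemma flag_chain A : flag A -> chain A.
Proof. by move=> /maxsetP[]. Qed.

Lemma chain_flag A : chain A -> exists2 B, flag B & A \subset B.
Proof. by move=> /maxset_exists[B]; exists B. Qed.

Lemma flag_eq_sub A B : flag A -> chain B -> A \subset B -> B = A.
Proof. by move=> /maxsetP[_ + cB]; apply. Qed.

Lemma chain1U F A : chain A -> {in A, forall G, F >=< G} -> chain (F |: A).
Proof.
move=> /chainP cA FA; apply/chainP => G H /setU1P[->|GA] /setU1P[->|HA].
- exact: comparablexx.
- exact: FA.
- by rewrite comparable_sym FA.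
- exact: cA.
Qed.

Lemma chain2 F G : F <= G -> chain [set F; G].
Proof.
move=> FG; apply: chain1U => [|H /set1P->]; last by rewrite /Order.comparable FG.
by apply/chainP => H H' /set1P-> /set1P->; apply: comparablexx.
Qed.

Definition flagT : Type := {A : {set T} | flag A}.
HB.instance Definition _ := Finite.on flagT.
HB.instance Definition _ := SubType.on flagT.

End Height.

(** * Flag graphs of polytopes *)

Section FlagGraph.
Context d (T : finPOrderType d) (n : nat) (polT : is_polytope T n).
Implicit Types (F G H : T) (A B : {set T}).

Implicit Types Phi Psi : flagT T.

Lemma flag_cmp Phi : {in val Phi &, forall F G, F >=< G}.
Proof. by apply/chainP/flag_chain/valP. Qed.

Lemma card_flag Phi : #|val Phi| = n.+2.
Proof. exact/(polytope_card_flag polT)/valP. Qed.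

Lemma chain_card_flag A : chain A -> #|A| = n.+2 -> flag A.
Proof.
move=> cA sA; have [B fB AB] := chain_flag cA.
suff -> : A = B by [].
by apply/eqP; rewrite eqEcard AB (polytope_card_flag polT fB) sA leqnn.
Qed.

(** A chain below [F] together with the part of [Phi] from [F] upwards is again a chain. It lies in
    a flag, and all flags have the same size, so it cannot have more elements than [Phi]. *)
Lemma height_flag Phi F :
  F \in val Phi -> height F = #|[set H in val Phi | H < F]|.
Proof.
move=> FP; apply/eqP; rewrite eqn_leq; apply/andP; split; last first.
  rewrite /height; apply: (@leq_bigmax_cond _ _ (fun A : {set T} => #|A|)).
  apply/andP; split; last by apply/subsetP => H; rewrite !inE => /andP[].
  by apply: (chain_sub _ (flag_chain (valP Phi))); apply/subsetP => H;
    rewrite inE => /andP[].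
apply/bigmax_leqP => A /andP[cA /subsetP AF].
have ltF H : H \in A -> H < F by move=> /AF; rewrite inE.
pose B := [set H in val Phi | F <= H].
have cAB : chain (A :|: B).
  apply/chainP => G H; rewrite !inE.
  case/orP => [GA|/andP[GP FG]] /orP[HA|/andP[HP FH]].
  - exact: (chainP _ cA).
  - by rewrite /Order.comparable (le_trans (ltW (ltF _ GA)) FH).
  - by rewrite /Order.comparable (le_trans (ltW (ltF _ HA)) FG) orbT.
  - exact: (flag_cmp GP HP).
have [C fC ABC] := chain_flag cAB.
have := subset_leq_card ABC; rewrite (polytope_card_flag polT fC) -(card_flag Phi).
have -> : #|A :|: B| = (#|A| + #|B|)%N.
  rewrite cardsU (_ : A :&: B = set0) ?cards0 ?subn0 //.
  apply/setP => H; rewrite !inE; apply/negP => /andP[/ltF HF /andP[_ FH]].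
  by have := lt_le_trans HF FH; rewrite ltxx.
have -> : #|val Phi| = (#|[set H in val Phi | (H < F)%O]| + #|B|)%N.
  rewrite -(cardsID B (val Phi)) addnC; congr (_ + _)%N; apply: eq_card => H;
    rewrite !inE; case: (boolP (H \in val Phi)) => //= HP; rewrite ?andbT.
  by have := flag_cmp HP FP; rewrite /Order.comparable; case: comparableP.
by rewrite leq_add2r.
Qed.

Lemma height_lt F G : F < G -> (height F < height G)%N.
Proof.
move=> FG; have [A fA /subsetP sA] := chain_flag (chain2 (ltW FG)).
have FA : F \in val (exist _ A fA : flagT T) by apply: sA; rewrite !inE eqxx.
have GA : G \in val (exist _ A fA : flagT T) by apply: sA; rewrite !inE eqxx orbT.
rewrite (height_flag FA) (height_flag GA); apply/proper_card/properP; split.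
  by apply/subsetP => H; rewrite !inE => /andP[-> /lt_trans->].
by exists F; rewrite !inE ?FA // ltxx.
Qed.

Lemma flag_le Phi F G : F \in val Phi -> G \in val Phi ->
  (F <= G) = (height F <= height G)%N.
Proof.
move=> FP GP; have := flag_cmp FP GP; rewrite /Order.comparable.
by case: (comparableP F G) => [/height_lt|/height_lt|//|->] //=; lia.
Qed.

Lemma flag_height_inj Phi : {in val Phi &, injective (@height _ T)}.
Proof.
move=> F G FP GP e; apply/le_anti.
by rewrite !(@flag_le Phi) ?e // leqnn.
Qed.

Lemma exists_flag F : exists Phi, F \in val Phi.
Proof.
have [A fA /subsetP sA] := chain_flag (chain2 (lexx F)).
by exists (exist _ A fA : flagT T); apply: sA; rewrite !inE eqxx.
Qed.

Lemma height_ltn F : (height F < n.+2)%N.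
Proof.
have [Phi FP] := exists_flag F; rewrite (height_flag FP) -(card_flag Phi).
apply/proper_card/properP; split; last by exists F; rewrite ?inE ?ltxx ?andbF.
by apply/subsetP => H; rewrite inE => /andP[].
Qed.

Lemma ex_face Phi (i : nat) : (i < n.+2)%N -> exists2 F, F \in val Phi & height F = i.
Proof.
move=> i_lt; pose h F : 'I_n.+2 := inord (height F).
have hE F : h F = height F :> nat by rewrite inordK ?height_ltn.
have : h @: val Phi = setT.
  apply/eqP; rewrite eqEcard subsetT /= card_in_imset ?card_flag ?cardsT ?card_ord //.
  by move=> F G FP GP /(congr1 val) /=; rewrite !hE; apply: (@flag_height_inj Phi).
move=> /setP/(_ (Ordinal i_lt)); rewrite inE => /imsetP[F FP e].
by exists F; rewrite // -hE -e.
Qed.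

Variable t0 : T.

(** The index is the height, so this is the face of rank [i - 1]. The default [t0] is returned only
    for [i >= n.+2]. *)
Definition face Phi (i : nat) : T :=
  odflt t0 [pick F in val Phi | height F == i].

Lemma faceP Phi i : (i < n.+2)%N -> face Phi i \in val Phi /\ height (face Phi i) = i.
Proof.
move=> /(ex_face Phi)[F FP Fi]; rewrite /face; case: pickP => [G|] /=.
  by case/andP=> -> /eqP.
by move=> /(_ F); rewrite FP Fi eqxx.
Qed.

Lemma face_in Phi i : (i < n.+2)%N -> face Phi i \in val Phi.
Proof. by case/(faceP Phi). Qed.

Lemma height_face Phi i : (i < n.+2)%N -> height (face Phi i) = i.
Proof. by case/(faceP Phi). Qed.

Lemma face_height Phi F : F \in val Phi -> face Phi (height F) = F.
Proof.
move=> FP; apply: (@flag_height_inj Phi) => //.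
  exact/face_in/height_ltn.
exact/height_face/height_ltn.
Qed.

Lemma face_eq Phi F i : F \in val Phi -> height F = i -> face Phi i = F.
Proof. by move=> FP <-; apply: face_height. Qed.

Lemma face_le Phi i j : (i < n.+2)%N -> (j < n.+2)%N ->
  (face Phi i <= face Phi j) = (i <= j)%N.
Proof. by move=> iN jN; rewrite (@flag_le Phi) ?height_face ?face_in. Qed.

Lemma face_lt Phi i j : (i < n.+2)%N -> (j < n.+2)%N ->
  (face Phi i < face Phi j) = (i < j)%N.
Proof.
move=> iN jN; rewrite lt_neqAle face_le // ltn_neqAle; congr (_ && _).
apply/negb_inj; rewrite !negbK; apply/eqP/eqP => [e|->//].
by rewrite -(height_face Phi iN) e height_face.
Qed.

Lemma flagT_sub Phi Psi : val Phi \subset val Psi -> Phi = Psi.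
Proof.
by move=> s; apply/esym/val_inj/flag_eq_sub => //; [apply: valP | apply/flag_chain/valP].
Qed.

Lemma flag_face_eq Phi Psi :
  (forall i, (i < n.+2)%N -> face Phi i = face Psi i) -> Phi = Psi.
Proof.
move=> e; apply/flagT_sub/subsetP => F FP.
by rewrite -(face_height FP) e ?face_in ?height_ltn.
Qed.

Lemma face_le_flag Phi Psi i j : (i < n.+2)%N -> (j < n.+2)%N ->
  face Phi i <= face Psi j <->
  (i <= j)%N /\ exists Om, face Om i = face Phi i /\ face Om j = face Psi j.
Proof.
move=> iN jN; split=> [le_ij | [le_ij [Om [<- <-]]]]; last by rewrite face_le.
have [A fA /subsetP sA] := chain_flag (chain2 le_ij).
pose Om := exist _ A fA : flagT T.
have eI : face Om i = face Phi i.
  by apply: face_eq; [apply: sA; rewrite !inE eqxx | apply: height_face].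
have eJ : face Om j = face Psi j.
  by apply: face_eq; [apply: sA; rewrite !inE eqxx orbT | apply: height_face].
by split; [rewrite -(face_le Om iN jN) eI eJ | exists Om].
Qed.

Lemma face_min Phi Psi : face Phi 0 = face Psi 0.
Proof.
have [m mP] := polytope_min polT.
suff e Om : face Om 0 = m by rewrite !e.
have mO : m \in val Om.
  have : chain (m |: val Om).
    by apply: chain1U => [|G _]; [apply/flag_chain/valP | rewrite /Order.comparable mP].
  by move=> /(flag_eq_sub (valP Om)) <-; rewrite ?subsetUr ?setU11.
by apply/le_anti; rewrite mP -{1}(face_height mO) face_le ?height_ltn.
Qed.

Lemma face_max Phi Psi : face Phi n.+1 = face Psi n.+1.
Proof.
have [m mP] := polytope_max polT.
suff e Om : face Om n.+1 = m by rewrite !e.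
have mO : m \in val Om.
  have : chain (m |: val Om).
    apply: chain1U => [|G _]; first exact/flag_chain/valP.
    by rewrite /Order.comparable mP orbT.
  by move=> /(flag_eq_sub (valP Om)) <-; rewrite ?subsetUr ?setU11.
by apply/le_anti; rewrite mP -{1}(face_height mO) face_le ?height_ltn // -ltnS height_ltn.
Qed.

(** Colour [l] changes the face of rank [l], whose height is [l.+1]. *)
Definition adj_spec l Phi Psi :=
  (Psi != Phi) && [forall i : 'I_n.+2, (i != l.+1 :> nat) ==> (face Psi i == face Phi i)].

Lemma adj_specP l Phi Psi : reflect (Psi <> Phi /\
    forall i, (i < n.+2)%N -> i != l.+1 -> face Psi i = face Phi i)
  (adj_spec l Phi Psi).
Proof.
apply: (iffP andP) => [[/eqP ne /forallP e]|[/eqP ne e]]; split=> //.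
  by move=> i iN il; apply/eqP; have /implyP := e (Ordinal iN); apply.
by apply/forallP => i; apply/implyP => il; rewrite e.
Qed.

Lemma adj_spec_sym l Phi Psi : adj_spec l Phi Psi -> adj_spec l Psi Phi.
Proof.
move=> /adj_specP[ne e]; apply/adj_specP; split=> [/esym//|i iN il].
by rewrite e.
Qed.

Lemma adj_spec_neq l Phi Psi : adj_spec l Phi Psi -> face Psi l.+1 <> face Phi l.+1.
Proof.
move=> /adj_specP[ne e] e'; apply/ne/flag_face_eq => i iN.
by have [->//|] := eqVneq i l.+1; apply: e.
Qed.

Lemma adj_spec_lt l Phi Psi : adj_spec l Phi Psi -> (l < n)%N.
Proof.
move=> a; have ne := adj_spec_neq a; rewrite ltnNge; apply/negP => nl; apply: ne.
have [->|lN] := eqVneq l n; first exact: face_max.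
have fE Om : face Om l.+1 = t0.
  rewrite /face; case: pickP => //= F /andP[_ /eqP e].
  by have := height_ltn F; rewrite e; lia.
by rewrite !fE.
Qed.

Lemma diamond_flag l Phi : (l < n)%N ->
  #|[set H | face Phi l < H < face Phi l.+2]| = 2.
Proof.
move=> ln; apply: (polytope_diamond polT ln); first by rewrite face_lt; lia.
  by apply/rank_height; rewrite height_face; lia.
have -> : (l%:Z + 1 = l.+2%:Z - 1)%R by lia.
by apply/rank_height; rewrite height_face; lia.
Qed.

Lemma adj_spec_uniq l Phi Psi Psi' :
  adj_spec l Phi Psi -> adj_spec l Phi Psi' -> Psi = Psi'.
Proof.
move=> a a'; have ln := adj_spec_lt a; have D := diamond_flag Phi ln.
have ne := adj_spec_neq a; have ne' := adj_spec_neq a'.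
have /adj_specP[_ e] := a; have /adj_specP[_ e'] := a'.
apply: flag_face_eq => i iN; have [->|il] := eqVneq i l.+1; last by rewrite e ?e'.
have inD Om : (forall i, (i < n.+2)%N -> i != l.+1 -> face Om i = face Phi i) ->
    face Om l.+1 \in [set H | face Phi l < H < face Phi l.+2].
  by move=> eO; rewrite inE -!eO ?face_lt; lia.
have /cards2P[x [y [_ E]]] : #|[set H | face Phi l < H < face Phi l.+2]| == 2.
  by rewrite D.
move: (inD Phi (fun _ _ _ => erefl)) (inD _ e) (inD _ e'); rewrite E => m0 m m'.
exact: two_values ne ne' m0 m m'.
Qed.

Lemma adj_spec_ex l Phi : (l < n)%N -> exists Psi, adj_spec l Phi Psi.
Proof.
move=> ln; have D := diamond_flag Phi ln.
have inD : face Phi l.+1 \in [set H | face Phi l < H < face Phi l.+2].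
  by rewrite inE !face_lt; lia.
have /card_gt0P[H] : (0 < #|[set H | (face Phi l < H < face Phi l.+2)%O] :\ face Phi l.+1|)%N.
  by move: D; rewrite (cardsD1 (face Phi l.+1)) inD add1n => -[->].
rewrite !inE => /and3P[ne lH Hl].
have cA : chain (H |: (val Phi :\ face Phi l.+1)).
  apply: chain1U; first exact: (chain_sub (subD1set _ _) (flag_chain (valP Phi))).
  move=> G /setD1P[neG GP]; have iN := height_ltn G.
  have := face_height GP; set i := height G in iN * => e.
  have : i != l.+1 by apply: contra_neq neG => <-.
  rewrite neq_ltn => /orP[il|il].
    by rewrite /Order.comparable (le_trans _ (ltW lH)) ?orbT // -e face_le; lia.
  by rewrite /Order.comparable (le_trans (ltW Hl)) // -e face_le; lia.
have [A fA /subsetP sA] := chain_flag cA; pose Psi := exist _ A fA : flagT T.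
have e i : (i < n.+2)%N -> i != l.+1 -> face Psi i = face Phi i.
  move=> iN il; apply: face_eq; last exact: height_face.
  apply/sA/setU1P; right; rewrite !inE face_in // andbT.
  by apply: contra_neq il => /(congr1 (@height _ _)); rewrite !height_face; lia.
exists Psi; apply/adj_specP; split=> // eP; move/eqP: ne; apply.
have HP : H \in val Phi by rewrite -eP; apply/sA/setU11.
apply/esym/face_eq => //; apply/eqP; rewrite eqn_leq.
have := height_lt lH; have := height_lt Hl; rewrite !height_face; lia.
Qed.

(** The value [Phi] for [l >= n], where no adjacent flag exists, makes this an involution for every
    [l]. *)
Definition fadj l Phi := odflt Phi [pick Psi | adj_spec l Phi Psi].

Lemma fadjP l Phi : (l < n)%N -> adj_spec l Phi (fadj l Phi).
Proof.
move=> /(adj_spec_ex Phi)[Psi a]; rewrite /fadj; case: pickP => //= /(_ Psi).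
by rewrite a.
Qed.

Lemma fadj_eq l Phi Psi : adj_spec l Phi Psi -> fadj l Phi = Psi.
Proof. by move=> a; apply: (adj_spec_uniq _ a); apply/fadjP/adj_spec_lt/a. Qed.

Lemma fadj_ge l Phi : (n <= l)%N -> fadj l Phi = Phi.
Proof.
by move=> nl; rewrite /fadj; case: pickP => //= Psi /adj_spec_lt; lia.
Qed.

Lemma fadjK l : involutive (fadj l).
Proof.
move=> Phi; have [ln|nl] := ltnP l n; last by rewrite !fadj_ge.
exact/fadj_eq/adj_spec_sym/fadjP.
Qed.

Lemma face_fadj l Phi i : (i < n.+2)%N -> i != l.+1 -> face (fadj l Phi) i = face Phi i.
Proof.
move=> iN il; have [ln|nl] := ltnP l n; last by rewrite fadj_ge.
by have /adj_specP[_ ->] := fadjP Phi ln.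
Qed.

Lemma face_fadj_neq l Phi : (l < n)%N -> face (fadj l Phi) l.+1 <> face Phi l.+1.
Proof. by move=> /(fadjP Phi)/adj_spec_neq. Qed.

(** The faces of heights [l] and [l.+2] determine the diamond, and the face of height [l.+1] tells
    which of its two elements is the new one. This locality is what makes colours at distance at
    least 2 commute. *)
Lemma fadj_local l Phi Psi : (l < n)%N ->
  (forall i, (l <= i <= l.+2)%N -> face Phi i = face Psi i) ->
  face (fadj l Phi) l.+1 = face (fadj l Psi) l.+1.
Proof.
move=> ln e; have D := diamond_flag Phi ln.
have /cards2P[x [y [_ E]]] : #|[set H | face Phi l < H < face Phi l.+2]| == 2.
  by rewrite D.
have inD0 : face Phi l.+1 \in [set H | face Phi l < H < face Phi l.+2].
  by rewrite inE !face_lt; lia.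
have inD Om : face Om l = face Phi l -> face Om l.+2 = face Phi l.+2 ->
    face (fadj l Om) l.+1 \in [set H | face Phi l < H < face Phi l.+2].
  move=> <- <-; rewrite inE -(@face_fadj l Om l) -?(@face_fadj l Om l.+2);
    by rewrite ?face_lt; lia.
have [e0 e1 e2] : [/\ face Psi l = face Phi l, face Psi l.+1 = face Phi l.+1
    & face Psi l.+2 = face Phi l.+2] by split; rewrite -e //; lia.
move: inD0 (inD Phi erefl erefl) (inD Psi e0 e2); rewrite E.
by apply: two_values; [exact: face_fadj_neq | rewrite -e1; exact: face_fadj_neq].
Qed.

Lemma fadjC l m : (l.+1 < m)%N -> forall Phi, fadj l (fadj m Phi) = fadj m (fadj l Phi).
Proof.
move=> lm Phi; have [mn|nm] := ltnP m n; last by rewrite !(@fadj_ge m).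
have ln : (l < n)%N by lia.
have e i : (i < n.+2)%N -> i != l.+1 -> i != m.+1 ->
    face (fadj m (fadj l Phi)) i = face Phi i.
  by move=> iN il im; rewrite !face_fadj.
apply: fadj_eq; apply/adj_specP; split; last first.
  move=> i iN il; have [->|im] := eqVneq i m.+1; last by rewrite e ?face_fadj.
  apply: fadj_local => // j /andP[mj jm].
  by apply: face_fadj; lia.
move=> /(congr1 (fun Om => face Om l.+1)).
rewrite (@face_fadj m) ?(@face_fadj m Phi l.+1); do ?lia.
exact: face_fadj_neq.
Qed.

Lemma adjacent_fadj Phi Psi : adjacent (val Phi) (val Psi) ->
  exists2 l, (l < n)%N & Psi = fadj l Phi.
Proof.
case/and4P=> _ _ /cards1P[F DE] _.
have /setDP[FP FPsi] : F \in val Phi :\: val Psi by rewrite DE set11.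
have e i : (i < n.+2)%N -> i != height F -> face Psi i = face Phi i.
  move=> iN iF; apply: face_eq; last exact: height_face.
  apply/negP => /negP nP; have : face Phi i \in val Phi :\: val Psi.
    by apply/setDP; rewrite face_in.
  by rewrite DE => /set1P eF; move: iF; rewrite -eF height_face ?eqxx.
have hF := height_ltn F.
have nF : face Psi (height F) <> F by move=> eF; move: FPsi; rewrite -eF face_in.
(* The minimum belongs to every flag, so the exchanged face has positive height and the predecessor
   of that height is a colour. *)
have [h0|h0] := posnP (height F).
  by case: nF; rewrite h0 (face_min _ Phi) -h0 face_height.
have hl : (height F).-1.+1 = height F by lia.
have a : adj_spec (height F).-1 Phi Psi.
  apply/adj_specP; split; last by rewrite hl.
  by move=> eP; case: nF; rewrite eP face_height.
by exists (height F).-1; [apply: adj_spec_lt a | rewrite (fadj_eq a)].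
Qed.

Lemma fadj_adjacent l Phi : (l < n)%N -> adjacent (val Phi) (val (fadj l Phi)).
Proof.
move=> ln.
have D Psi Psi' : adj_spec l Psi Psi' -> val Psi :\: val Psi' = [set face Psi l.+1].
  move=> a; have /adj_specP[_ e] := a; apply/setP => F; rewrite !inE.
  apply/andP/eqP => [[FP FPsi]|->].
    apply: contraNeq FP => Fl; rewrite -(face_height FPsi) -e ?face_in ?height_ltn //.
    by apply: contra_neq Fl => <-; rewrite face_height.
  rewrite face_in; last by lia.
  split=> //; apply/negP => FP; apply: (adj_spec_neq a).
  by apply: face_eq => //; rewrite height_face; lia.
have a := fadjP Phi ln; rewrite /adjacent (D _ _ a) (D _ _ (adj_spec_sym a)) !cards1.
by rewrite (valP Phi) (valP (fadj l Phi)).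
Qed.

Notation con := (con fadj n).
Notation walk := (walk fadj).

Lemma con_face (p : pred nat) Phi Psi i : (i < n.+2)%N ->
  (forall l, (l < n)%N -> p l -> i != l.+1) -> con p Phi Psi -> face Psi i = face Phi i.
Proof.
move=> iN pi; apply: (@con_ind _ _ _ _ (fun Om => face Om i = face Phi i)) => //.
by move=> Om l ln pl <-; rewrite face_fadj ?pi.
Qed.

(** Strong flag connectivity in terms of colours: a path that keeps all common faces never uses the
    colour of a rank in which the two flags agree. *)
Lemma con_flag Phi Psi : con (fun l => face Phi l.+1 != face Psi l.+1) Phi Psi.
Proof.
set C := val Phi :&: val Psi.
have inC l : (l < n)%N -> face Phi l.+1 = face Psi l.+1 -> face Phi l.+1 \in C.
  by move=> ln e; rewrite inE {2}e !face_in; lia.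
have gen s : forall Om : flagT T, path (adjacent_through C) (val Om) s ->
    val Psi = last (val Om) s -> con (fun l => face Phi l.+1 != face Psi l.+1) Om Psi.
  elim: s => [|A s IHs] Om /=.
    by move=> _ e; have -> : Psi = Om by [apply: val_inj]; apply: con_refl.
  move=> /andP[/and3P[CO CA aOA] ps] el.
  have fA : flag A by case/and4P: aOA.
  have [l ln E] := @adjacent_fadj Om (exist _ A fA) aOA.
  apply: con_trans (IHs (exist _ A fA : flagT T) ps el); rewrite E; apply: con_r => //.
  apply/eqP => e; have F := inC l ln e; apply: (@face_fadj_neq l Om ln); rewrite -E.
  have eT (Th : flagT T) : face Phi l.+1 \in val Th -> face Th l.+1 = face Phi l.+1.
    by move=> FT; apply: face_eq => //; rewrite height_face; lia.
  by rewrite !eT // ?(subsetP CO) ?(subsetP CA).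
have /connectP[s] := polytope_connected polT (valP Phi) (valP Psi).
exact: gen.
Qed.

(* [g] need not be monotone on T: it may be an automorphism of a facet in Phi, *)
(* extended by the identity.                                                   *)
Definition map_flag (g : T -> T) Phi : flagT T := insubd Phi (g @: val Phi).

Definition embeds (g : T -> T) Phi :=
  {in val Phi &, forall F G, (g F <= g G) = (F <= G)}.

Lemma embeds_inj g Phi : embeds g Phi -> {in val Phi &, injective g}.
Proof.
move=> emb F G FP GP e; apply/le_anti.
by rewrite -(emb F G) // -(emb G F) // e lexx.
Qed.

Lemma val_map_flag g Phi : embeds g Phi -> val (map_flag g Phi) = g @: val Phi.
Proof.
move=> emb; rewrite val_insubd ifT //; apply: chain_card_flag.
  apply/chainP => _ _ /imsetP[F FP ->] /imsetP[G GP ->].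
  by rewrite /Order.comparable !emb //; apply: (flag_cmp FP GP).
by rewrite card_in_imset ?card_flag //; apply: embeds_inj.
Qed.

Lemma face_map_flag g Phi i : embeds g Phi -> (i < n.+2)%N ->
  face (map_flag g Phi) i = g (face Phi i).
Proof.
move=> emb iN; have FP := face_in Phi iN.
have gF : g (face Phi i) \in val (map_flag g Phi).
  by rewrite val_map_flag // imset_f.
apply: face_eq => //; rewrite -{2}(height_face Phi iN) (height_flag gF) (height_flag FP).
have lt_emb F G : F \in val Phi -> G \in val Phi -> (g F < g G) = (F < G).
  by move=> FiP GP; rewrite !lt_leAnge !emb.
rewrite -(@card_in_imset _ _ g (mem [set H in val Phi | (H < face Phi i)%O])).
  apply: eq_card => H; rewrite inE val_map_flag //; apply/andP/imsetP.
    case=> /imsetP[G GP ->]; rewrite lt_emb // => lt.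
    by exists G; rewrite // inE GP.
  by case=> G; rewrite inE => /andP[GP lt] ->; rewrite imset_f // lt_emb.
by move=> F G; rewrite !inE => /andP[FiP _] /andP[GP _]; apply: embeds_inj emb _ _ FiP GP.
Qed.

Lemma fadj_map_flag g Phi l : injective g -> embeds g Phi -> embeds g (fadj l Phi) ->
  fadj l (map_flag g Phi) = map_flag g (fadj l Phi).
Proof.
move=> gI emb emb'; have [ln|nl] := ltnP l n; last by rewrite !fadj_ge.
apply: fadj_eq; apply/adj_specP; split=> [|i iN il]; last first.
  by rewrite !face_map_flag // face_fadj.
move=> /(congr1 (fun Om => face Om l.+1)); rewrite !face_map_flag //; do ?lia.
by move=> /gI; apply: face_fadj_neq.
Qed.

(** Incident faces share a flag, and moving to it from each side leaves the face in question fixed.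
    So incidence depends on [Phi] only through the pairs of words that agree on it. *)
Lemma face_le_words Phi u v i j : word n predT u -> word n predT v ->
  (i < n.+2)%N -> (j < n.+2)%N ->
  (face (walk Phi u) i <= face (walk Phi v) j) <->
  (i <= j)%N /\ exists t t', [/\ word n (fun l => i != l.+1) t,
     word n (fun l => j != l.+1) t' & walk Phi (u ++ t) = walk Phi (v ++ t')].
Proof.
move=> wu wv iN jN; rewrite face_le_flag //; split=> -[ij].
  case=> Om [ei ej]; split=> //.
  have conOm Psi k : face Om k = face Psi k -> con (fun l => k != l.+1) Psi Om.
    move=> e; apply: con_sub (con_flag Psi Om) => l ln.
    by apply: contra_neq => <-.
  have /conP[t wt et] := conOm _ _ ei; have /conP[t' wt' et'] := conOm _ _ ej.
  by exists t, t'; split=> //; rewrite !walk_cat et et'.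
case=> t [t' [wt wt' e]]; split=> //; exists (walk Phi (u ++ t)); split.
  by rewrite walk_cat; apply: (@con_face (fun l => i != l.+1)) => //; apply/conP; exists t.
by rewrite e walk_cat; apply: (@con_face (fun l => j != l.+1)) => //; apply/conP; exists t'.
Qed.

Lemma walk_conT Phi Psi : exists2 u, word n predT u & walk Phi u = Psi.
Proof. by apply/conP; apply: con_sub (con_flag Phi Psi). Qed.

Lemma walk_face_surj Phi F : exists2 iu : nat * seq nat,
  (iu.1 < n.+2)%N && word n predT iu.2 & face (walk Phi iu.2) iu.1 = F.
Proof.
have [Psi FP] := exists_flag F; have [u wu e] := walk_conT Phi Psi.
by exists (height F, u); rewrite /= ?height_ltn ?wu // e face_height.
Qed.

(** * Automorphisms and words *)

Lemma aut_embeds g Phi : g \in poset_aut T -> embeds g Phi.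
Proof. by rewrite inE => /forallP gP F G _ _; have /forallP/(_ G)/eqP := gP F. Qed.

Lemma walk_map_aut g Phi u : g \in poset_aut T ->
  walk (map_flag g Phi) u = map_flag g (walk Phi u).
Proof.
move=> gA; elim: u Phi => //= l u IHu Phi.
by rewrite fadj_map_flag ?IHu //; [apply: perm_inj | apply: aut_embeds..].
Qed.

(** Expresses by words alone that two flags lie in the same orbit of the automorphism group; the
    next two lemmas give the two directions. In this form it can be carried from K to the extension
    and back. *)
Definition same_stab Phi Psi := forall u v, word n predT u -> word n predT v ->
  walk Phi u = walk Phi v <-> walk Psi u = walk Psi v.

Lemma aut_same_stab Phi g : g \in poset_aut T -> same_stab Phi (map_flag g Phi).
Proof.
move=> gA u v _ _; rewrite !walk_map_aut //; split=> [->//|e].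
apply: flag_face_eq => i iN; apply: (@perm_inj _ g).
by rewrite -!face_map_flag ?e //; apply: aut_embeds.
Qed.

(* A flag determines a coset model of the poset, with the stabilizer of the   *)
(* flag under the action of words as the only parameter.                      *)
Lemma same_stab_aut Phi Psi : same_stab Phi Psi ->
  exists2 g, g \in poset_aut T & map_flag g Phi = Psi.
Proof.
move=> PP.
have [h [hb hle hE]] : exists h : T -> T, [/\ bijective h,
    forall x y, (h x <= h y) = (x <= y) & forall iu : nat * seq nat,
    (iu.1 < n.+2)%N && word n predT iu.2 ->
    h (face (walk Phi iu.2) iu.1) = face (walk Psi iu.2) iu.1].
  apply: indexed_iso => [F|F|[i u] [j v] /= /andP[iN wu] /andP[jN wv]].
  - exact: walk_face_surj.
  - exact: walk_face_surj.
  apply/idP/idP => /face_le_words => /(_ wu wv iN jN)[ij [t [t' [wt wt' e]]]];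
    (apply/face_le_words => //; split=> //; exists t, t'; split=> //);
    have wut : word n predT (u ++ t) by [rewrite word_cat wu; apply: word_sub wt];
    have wvt' : word n predT (v ++ t') by [rewrite word_cat wv; apply: word_sub wt'];
    by apply/(PP _ _ wut wvt').
have gA : perm (bij_inj hb) \in poset_aut T.
  by rewrite inE; apply/forallP => F; apply/forallP => G; rewrite !permE hle.
exists (perm (bij_inj hb)) => //; apply: flag_face_eq => i iN.
by rewrite face_map_flag ?permE ?(hE (i, [::])) /= ?iN //; apply: aut_embeds.
Qed.

End FlagGraph.

(** * Chirality and reflections of facets *)

Section Chiral.
Context d (T : finPOrderType d) (n : nat) (polT : is_polytope T n) (t0 : T).
Implicit Types (F G H : T) (A B : {set T}) (Phi Psi : flagT T).

Notation face := (face t0).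
Notation fadj := (fadj n t0).
Notation con := (con fadj n).
Notation walk := (walk fadj).
Notation word := (word n).

Lemma orbit_flagP Phi Psi :
  orbit 'P^* (poset_aut T) (val Phi) = orbit 'P^* (poset_aut T) (val Psi) <->
  exists2 g, g \in poset_aut T & map_flag g Phi = Psi.
Proof.
have mapE g : g \in poset_aut T -> val (map_flag g Phi) = ('P^*)%act (val Phi) g.
  by move=> gA; rewrite (val_map_flag polT) ?setactE //; apply: aut_embeds.
split=> [e|[g gA <-]].
  have /orbitP[g gA eg] : val Psi \in orbit 'P^* (poset_aut T) (val Phi).
    by rewrite e orbit_refl.
  by exists g => //; apply: val_inj; rewrite mapE.
by rewrite mapE //; apply/esym/orbit_act.
Qed.

(** The colour of a flag is its orbit, compared with that of one fixed flag. There are only two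
    orbits, so adjacent flags get opposite colours and equal colours mean equal orbits. *)
Lemma chiral_color : is_chiral T -> exists c : flagT T -> bool,
  [/\ forall l Phi, (l < n)%N -> c (fadj l Phi) = ~~ c Phi,
      forall Phi Psi, c Phi = c Psi -> same_stab n t0 Phi Psi
    & forall Phi Psi, same_stab n t0 Phi Psi -> c Phi = c Psi].
Proof.
case=> card_orb adj_orb.
pose orb Phi := orbit 'P^* (poset_aut T) (val Phi).
have [Phi0 _] := exists_flag t0.
have /cards2P[O [O' [_ E]]] : #|orbit 'P^* (poset_aut T) @: flags T| == 2.
  by rewrite card_orb.
have inO Phi : orb Phi \in [set O; O'] by rewrite -E; apply: imset_f; rewrite inE; apply: valP.
exists (fun Phi => orb Phi == orb Phi0); split.
- move=> l Phi ln; have ne := adj_orb _ _ (fadj_adjacent polT t0 Phi ln).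
  have [<-|ne0] := eqVneq (orb Phi) (orb Phi0).
    by apply/negbTE; rewrite eq_sym.
  apply/eqP; apply: (two_values _ _ (inO Phi) (inO _) (inO _)); apply/eqP.
    by rewrite eq_sym.
  by rewrite eq_sym.
- move=> Phi Psi e; have /orbit_flagP[g gA <-] : orb Phi = orb Psi; last exact: aut_same_stab.
  have [eP|ne] := eqVneq (orb Phi) (orb Phi0).
    by move: e; rewrite eP eqxx => /esym/eqP.
  have ne' : orb Psi != orb Phi0 by rewrite -e.
  by apply: (two_values _ _ (inO Phi0) (inO _) (inO _)); apply/eqP.
- by move=> Phi Psi /(same_stab_aut polT)/orbit_flagP; rewrite /orb => ->.
Qed.

(** An automorphism of the facet takes the trace of [Psi] to that of [Psi']. Extended by the
    identity to faces not below [F], it preserves the order on each flag through [F], hence commutes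
    with every adjacency that keeps [F]. *)
Lemma regular_facet_map F Psi Psi' : height F = n -> is_regular (face_section F) ->
  F \in val Psi -> F \in val Psi' ->
  exists2 f : flagT T -> flagT T, f Psi = Psi' &
    forall Phi, F \in val Phi -> F \in val (f Phi) /\
      forall l, F \in val (fadj l Phi) -> f (fadj l Phi) = fadj l (f Phi).
Proof.
move=> hF regF FPsi FPsi'.
pose res Phi : {set face_section F} := [set h | val h \in val Phi].
have flag_res Phi : F \in val Phi -> flag (res Phi).
  move=> FP; apply/maxsetP; split=> [|B cB sB].
    apply/chainP => G H; rewrite !inE => GP HP.
    by have := flag_cmp GP HP; rewrite /Order.comparable !leEsub.
  apply/eqP; rewrite eqEsubset sB andbT; apply/subsetP => h hB; rewrite inE.
  (* To see that the trace of [Phi] is maximal, a larger chain [B] in the facet is completed by the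
     faces of [Phi] not below [F]; maximality of [Phi] then bounds [B]. *)
  pose A := val @: B :|: [set H in val Phi | ~~ (H <= F)].
  have cA : chain A.
    have FG H : H \in val Phi -> ~~ (H <= F) -> F <= H.
      by move=> HP; have := flag_cmp FP HP; rewrite /Order.comparable orbC; case: (H <= F).
    apply/chainP => G H; rewrite !inE.
    move=> /orP[/imsetP[g gB ->]|/andP[GP nGF]] /orP[/imsetP[k kB ->]|/andP[HP nHF]].
    - by have := (chainP _ cB) _ _ gB kB; rewrite /Order.comparable !leEsub.
    - by rewrite /Order.comparable (le_trans (valP g)) ?FG.
    - by rewrite /Order.comparable (le_trans (valP k)) ?FG ?orbT.
    - exact: (flag_cmp GP HP).
  have : val Phi \subset A.
    apply/subsetP => H HP; rewrite !inE; have [HF|] := boolP (H <= F); last first.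
      by rewrite HP orbT.
    apply/orP; left; apply/imsetP; exists (exist _ H HF : face_section F) => //.
    by apply: (subsetP sB); rewrite inE.
  move=> /(flag_eq_sub (valP Phi) cA) <-.
  by rewrite inE imset_f.
have resS Phi : F \in val Phi -> res Phi \in flags (face_section F).
  by move=> FP; rewrite inE flag_res.
have [phi phiA phiE] := atransP2 regF (resS _ FPsi) (resS _ FPsi').
pose g H : T := if insub H is Some h then val (phi h) else H.
have gE (h : face_section F) : g (val h) = val (phi h) by rewrite /g valK.
have gid H : ~~ (H <= F) -> g H = H by move=> HF; rewrite /g insubN.
have gle H : H <= F -> g H <= F.
  by move=> HF; rewrite (gE (exist _ H HF : face_section F)); apply: (valP (phi _)).
have gmono H G : H <= F -> G <= F -> (g H <= g G) = (H <= G).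
  move=> HF GF; rewrite (gE (exist _ H HF : face_section F)).
  rewrite (gE (exist _ G GF : face_section F)).
  rewrite -leEsub; move: phiA; rewrite inE => /forallP/(_ (exist _ H HF)).
  by move=> /forallP/(_ (exist _ G GF))/eqP->; rewrite leEsub.
have gI : injective g.
  move=> H G; have [HF|HF] := boolP (H <= F); have [GF|GF] := boolP (G <= F).
  - by move=> e; apply/le_anti; rewrite -(gmono H G) // -(gmono G H) // e lexx.
  - by rewrite (gid _ GF) => e; rewrite -e gle in GF.
  - by rewrite (gid _ HF) => e; rewrite e gle in HF.
  - by rewrite !gid.
have gF : g F = F.
  apply/le_anti; rewrite gle //=.
  pose f0 := exist _ F (lexx F) : face_section F.
  have eF : g (val (phi^-1%g f0)) = F by rewrite gE permKV.
  have le_f0 : val (phi^-1%g f0) <= F := valP (phi^-1%g f0).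
  by rewrite -{1}eF gmono.
have emb Phi : F \in val Phi -> embeds g Phi.
  move=> FP H G HP GP.
  have Fle K : K \in val Phi -> ~~ (K <= F) -> F < K.
    move=> KP nKF; rewrite lt_leAnge nKF andbT.
    by have := flag_cmp FP KP; rewrite /Order.comparable orbC (negbTE nKF).
  have [HF|HF] := boolP (H <= F); have [GF|GF] := boolP (G <= F).
  - exact: gmono.
  - by rewrite (gid _ GF) !(le_trans _ (ltW (Fle _ GP GF))) // gle.
  - rewrite (gid _ HF); apply/idP/idP => le.
      by have := le_trans le (gle _ GF); rewrite (negbTE HF).
    by have := le_trans le GF; rewrite (negbTE HF).
  - by rewrite !gid.
exists (map_flag g) => [|Phi FP].
  apply/flagT_sub/subsetP => K; rewrite (val_map_flag polT (emb _ FPsi)).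
  case/imsetP=> H HP ->; have [HF|HF] := boolP (H <= F).
    have : phi (exist _ H HF : face_section F) \in res Psi'.
      by rewrite phiE; apply: imset_f; rewrite inE.
    by rewrite inE -gE.
  (* The only face of a flag through [F] that is not below [F] is the maximum, which all flags
     share. *)
  rewrite gid //; have hH : height H = n.+1.
    have := height_ltn polT H; have : F < H; last by move/(height_lt polT); rewrite hF; lia.
    rewrite lt_leAnge HF andbT.
    by have := flag_cmp FPsi HP; rewrite /Order.comparable orbC (negbTE HF).
  by rewrite -(face_height polT t0 HP) hH (face_max polT t0 Psi Psi') (face_in polT).
split=> [|l FlP].
  by rewrite (val_map_flag polT (emb _ FP)) -{1}gF imset_f.
by rewrite (fadj_map_flag polT) //; apply: emb.
Qed.

End Chiral.

(** * Reflections of facets and chains of low rank *)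

Section Reflections.
Context d (T : finPOrderType d) (n : nat) (polT : is_polytope T n) (t0 : T).
Implicit Types (F G H : T) (Phi Psi : flagT T).

Notation face := (face t0).
Notation fadj := (fadj n t0).
Notation con := (con fadj n).

Definition agree (k : nat) Phi Psi := [forall i : 'I_k.+1, face Phi i == face Psi i].

Lemma agreeP k Phi Psi :
  reflect (forall i, (i <= k)%N -> face Phi i = face Psi i) (agree k Phi Psi).
Proof.
apply: (iffP forallP) => [e i ik|e i]; last by rewrite e // -ltnS.
by apply/eqP; apply: (e (Ordinal (_ : i < k.+1)%N)).
Qed.

Lemma agree_sym k Phi Psi : agree k Phi Psi = agree k Psi Phi.
Proof. by apply/agreeP/agreeP => e i /e. Qed.

Lemma agree_trans k Psi Phi Om : agree k Phi Psi -> agree k Psi Om -> agree k Phi Om.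
Proof.
by move=> /agreeP e /agreeP e'; apply/agreeP => i ik; rewrite e ?e'.
Qed.

(** The excluded colour is [k - 1]: the face of height [k] that it produces also depends on the face
    of height [k.+1], where nothing is assumed. *)
Lemma agree_fadj k l Phi Psi : (k <= n.+1)%N -> (l < n)%N ->
  (l.+2 <= k)%N || (k <= l)%N ->
  agree k Phi Psi -> agree k (fadj l Phi) (fadj l Psi).
Proof.
move=> kn ln lk /agreeP e; apply/agreeP => i ik.
have [il|il] := eqVneq i l.+1; last by rewrite !face_fadj ?e //; lia.
rewrite il; apply: fadj_local => // j /andP[lj jl]; apply: e; lia.
Qed.

Lemma con_agree k (p : pred nat) Phi Psi : (k <= n.+1)%N ->
  (forall l, (l < n)%N -> p l -> (k <= l)%N) -> con p Phi Psi -> agree k Psi Phi.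
Proof.
move=> kn pk c; apply/agreeP => i ik.
apply: (con_face polT _ _ c); first lia.
by move=> l ln /(pk l ln); lia.
Qed.

Lemma agree_con k Phi Psi : agree k Phi Psi ->
  con (fun l => (k <= l)%N && (face Phi l.+1 != face Psi l.+1)) Phi Psi.
Proof.
move=> /agreeP e; apply: con_sub (con_flag polT t0 Phi Psi) => l ln ne.
by rewrite ne andbT leqNgt; apply: contra ne => lk; rewrite e.
Qed.

(* The mirror is chosen so that Phi0 and [fadj (axis k) Phi0] agree in rank    *)
(* k - 1: their chains of faces of rank < k then lie in the same facets.       *)
Definition axis (k : nat) : nat := (k < 2)%N.

(** The reflection sends a base flag [Psi] through [F] to its neighbour of colour [axis k]. It
    commutes with the colours below [n - 1], which connect all flags through [F], so being an
    involution and reversing [c] need only be checked at [Psi]. *)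
Lemma facet_reflection (c : flagT T -> bool) (k : nat) Phi0 F :
  (3 <= n)%N -> (forall l Phi, (l < n)%N -> c (fadj l Phi) = ~~ c Phi) ->
  (k < n)%N -> (height F = n -> is_regular (face_section F)) ->
  exists f : flagT T -> flagT T, forall Phi, face Phi n = F ->
   [/\ face (f Phi) n = F, f (f Phi) = Phi,
       forall l, (l.+1 < n)%N -> f (fadj l Phi) = fadj l (f Phi),
       c (f Phi) = ~~ c Phi
     & (agree k Phi Phi0 -> agree k (f Phi) (fadj (axis k) Phi0)) /\
       (agree k Phi (fadj (axis k) Phi0) -> agree k (f Phi) Phi0)].
Proof.
move=> n3 cS kn regF; pose a := axis k.
have an : (a.+1 < n)%N by rewrite /a /axis; case: (k < 2)%N; lia.
have ak : (a.+2 <= k)%N || (k <= a)%N by rewrite /a /axis; case: ltnP; lia.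
have face_n l Phi : (l.+1 < n)%N -> face (fadj l Phi) n = face Phi n.
  by move=> ln; rewrite face_fadj //; lia.
(* The base flag is taken to agree with [Phi0] whenever some flag through [F] does. Otherwise any
   flag through [F] will do, and [Phi0] is a dummy if there is none. *)
have [Psi FPsi FPsik] : exists2 Psi, (exists Phi, face Phi n = F) -> face Psi n = F &
    (exists2 Phi, face Phi n = F & agree k Phi Phi0) -> agree k Psi Phi0.
  case: (pickP (fun Phi => (face Phi n == F) && agree k Phi Phi0)) => [Psi|no].
    by case/andP=> /eqP e ag; exists Psi.
  case: (pickP (fun Phi => (face Phi n == F))) => [Psi /eqP e|no'].
    by exists Psi => // -[Phi e' ag]; have := no Phi; rewrite e' eqxx ag.
  exists Phi0 => -[Phi].
    by move=> /eqP; rewrite no'.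
  by move=> e' ag; have := no Phi; rewrite e' eqxx ag.
have [exF|noF] := boolP [exists Phi, face Phi n == F]; last first.
  by exists id => Phi e; case/existsP: noF; exists Phi; apply/eqP.
have {exF}eF : face Psi n = F.
  by apply: FPsi; case/existsP: exF => Phi /eqP; exists Phi.
have hF : height F = n by rewrite -eF (height_face polT).
have inF Phi : face Phi n = F <-> F \in val Phi.
  split=> [<-|FP]; first exact: (face_in polT).
  by apply: (face_eq polT).
have [f fPsi fP] : exists2 f : flagT T -> flagT T, f Psi = fadj a Psi &
   forall Phi, face Phi n = F -> face (f Phi) n = F /\
    forall l, (l.+1 < n)%N -> f (fadj l Phi) = fadj l (f Phi).
  have FPsi1 : F \in val Psi by apply/inF.
  have FPsi2 : F \in val (fadj a Psi) by apply/inF; rewrite face_n.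
  have [f fPsi fP] := regular_facet_map polT t0 hF (regF hF) FPsi1 FPsi2.
  exists f => // Phi eP; have [/inF fF fA] := fP _ ((inF _).1 eP).
  by split=> // l ln; apply/fA/inF; rewrite face_n.
have connF Phi : face Phi n = F -> con (fun l => (l.+1 < n)%N) Psi Phi.
  move=> eP; apply: con_sub (con_flag polT t0 Psi Phi) => l ln.
  apply: contraR => ln'; have -> : l.+1 = n by lia.
  by rewrite eF eP.
have indF (Q : flagT T -> Prop) : Q Psi ->
    (forall l Phi, face Phi n = F -> (l.+1 < n)%N -> Q Phi -> Q (fadj l Phi)) ->
    forall Phi, face Phi n = F -> Q Phi.
  move=> Q0 QS Phi /connF.
  move=> /(@con_ind _ _ _ _ (fun Om => face Om n = F /\ Q Om)) []//.
  move=> Om l _ ln [eO qO]; split; first by rewrite face_n.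
  exact: QS.
(* [Psi] and [Phi] have the same faces of rank < k, so colours at least [k] lead from one to the
   other inside the facet. These commute with [f] and do not affect agreement up to height [k],
   which reduces the claim to [Psi]. *)
have f_agree Phi : face Phi n = F -> agree k Phi Phi0 -> agree k (f Phi) (fadj a Phi0).
  move=> eP ag; have agPsi : agree k Psi Phi0 by apply: FPsik; exists Phi.
  have : agree k Psi Phi by rewrite (agree_trans agPsi) // agree_sym.
  move/agree_con.
  move=> /(@con_ind _ _ _ _ (fun Om => face Om n = F /\ agree k (f Om) (fadj a Phi0))).
  case=> // [Om l ln /andP[kl ne] [eO agO]|].
    have ln' : (l.+1 < n)%N.
      rewrite ltn_neqAle ln andbT; apply: contra ne => /eqP->.
      by rewrite eF eP.
    split; first by rewrite face_n.
    have [_ ->] := fP _ eO; last by [].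
    apply: agree_trans agO; apply: (@con_agree k (fun m => m == l)); first lia.
      by move=> m _ /eqP->.
    exact: con_r.
  split=> //; rewrite fPsi; apply: agree_fadj => //; lia.
exists f => Phi eP; have [fF fA] := fP _ eP; split=> //.
- move: Phi eP {fF fA}; apply: indF.
    by rewrite fPsi (fP _ _).2 // fPsi fadjK.
  move=> l Phi eP ln e; have [fF fA] := fP _ eP.
  by rewrite fA // (fP _ fF).2 // e.
- move: Phi eP {fF fA}; apply: indF; first by rewrite fPsi cS //; lia.
  move=> l Phi eP ln e; have [fF fA] := fP _ eP.
  by rewrite fA // !cS ?e //; lia.
- split; first exact: f_agree.
  move=> ag.
  (* The converse exchange is the first one applied to [fadj a Phi], since [f] commutes with colour
     [a]. *)
  have : agree k (f (fadj a Phi)) (fadj a Phi0).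
    apply: f_agree; first by rewrite face_n.
    by rewrite -[Phi0](fadjK polT t0 a); apply: agree_fadj => //; lia.
  rewrite fA // => /(agree_fadj _ _ ak); rewrite !fadjK //; apply; lia.
Qed.

(** Each reflection fixes its facet, so choosing one separately for every index and every facet
    still yields involutions on all flags. *)
Lemma facet_reflections (c : flagT T -> bool) Phi0 :
  (3 <= n)%N -> (forall l Phi, (l < n)%N -> c (fadj l Phi) = ~~ c Phi) ->
  (forall F, height F = n -> is_regular (face_section F)) ->
  exists f : 'I_n -> flagT T -> flagT T, forall k Phi,
   [/\ face (f k Phi) n = face Phi n, f k (f k Phi) = Phi,
       forall l, (l.+1 < n)%N -> f k (fadj l Phi) = fadj l (f k Phi),
       c (f k Phi) = ~~ c Phi
     & (agree k Phi Phi0 -> agree k (f k Phi) (fadj (axis k) Phi0)) /\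
       (agree k Phi (fadj (axis k) Phi0) -> agree k (f k Phi) Phi0)].
Proof.
move=> n3 cS regF.
have [f fP] := fin_all_exists (fun kF : 'I_n * T =>
  facet_reflection Phi0 n3 cS (ltn_ord kF.1) (regF kF.2)).
exists (fun k Phi => f (k, face Phi n) Phi) => k Phi.
have [-> ? fA ? ?] := fP (k, face Phi n) Phi erefl; split=> // l ln.
by rewrite face_fadj ?fA //; lia.
Qed.

End Reflections.

(** * From maniplexes to polytopes *)

(** An axiomatization of flag graphs by involutions: far colours commute, the graph is connected,
    and [pol_wpip] is the weak path intersection property, asked only for an initial and a final
    interval of colours. *)
Record polytopal (M : finType) (N : nat) (r : nat -> M -> M) : Prop := Polytopal {
  pol_rK : forall l, (l < N)%N -> involutive (r l);
  pol_rC : forall l m x, (l.+1 < m)%N -> (m < N)%N -> r l (r m x) = r m (r l x);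
  pol_neq : forall l x, (l < N)%N -> r l x <> x;
  pol_con : forall x y, con r N predT x y;
  pol_wpip : forall k m x y, con r N (fun l => (l < m)%N) x y ->
    con r N (fun l => (k <= l)%N) x y -> con r N (fun l => (k <= l < m)%N) x y
}.

Section Maniplex.
Context (M : finType) (N : nat) (r : nat -> M -> M) (polM : polytopal N r).
Implicit Types (x y z : M) (i j k l m : nat) (p q : pred nat).

Notation con := (con r N).

Let sym p x y : con p x y -> con p y x.
Proof. exact: con_symW (pol_rK polM) _ _ _. Qed.

Lemma con_comm p l x y : (l < N)%N ->
  (forall m, (m < N)%N -> p m -> (l.+1 < m)%N || (m.+1 < l)%N) ->
  con p x y -> con p (r l x) (r l y).
Proof.
move=> lN pl; apply: (@con_ind _ _ _ _ (fun z => con p (r l x) (r l z))); last first.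
  exact: con_refl.
move=> z m mN pm xz; apply: con_trans xz _.
have -> : r l (r m z) = r m (r l z).
  by case/orP: (pl m mN pm) => h; [|apply/esym]; apply: (pol_rC polM).
exact: con_r.
Qed.

(** Without colour [i - 1], every remaining low colour commutes with every remaining high one, so
    the steps of a path can be sorted. *)
Lemma con_split p i x y : (forall l, p l -> i != l.+1) -> con p x y ->
  exists2 z, con (fun l => p l && (l.+1 < i)%N) x z & con (fun l => p l && (i <= l)%N) z y.
Proof.
move=> pi; apply: (@con_ind _ _ _ _ (fun y => exists2 z,
  con (fun l => p l && (l.+1 < i)%N) x z & con (fun l => p l && (i <= l)%N) z y)); last first.
  by exists x; apply: con_refl.
move=> {}y l lN pl [z xz zy]; have := pi _ pl.
rewrite neq_ltn => /orP[il|li].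
  by exists z => //; apply: con_trans zy _; apply: con_r => //; rewrite pl.
exists (r l z); first by apply: con_trans xz _; apply: con_r => //; rewrite pl.
by apply: con_comm => // m mN /andP[pm im]; apply/orP; left; lia.
Qed.

Lemma con_split_rev p i x y : (forall l, p l -> i != l.+1) -> con p x y ->
  exists2 z, con (fun l => p l && (i <= l)%N) x z & con (fun l => p l && (l.+1 < i)%N) z y.
Proof. by move=> pi /sym/(con_split pi)[z /sym yz /sym zx]; exists z. Qed.

Lemma last_before (J : pred nat) b :
  (forall i, (i < b)%N -> ~~ J i) \/
  exists j, [/\ (j < b)%N, J j & forall i, (j < i < b)%N -> ~~ J i].
Proof.
elim: b => [|b [no|[j [jb Jj no]]]]; first by left.
  have [Jb|nJb] := boolP (J b); [right; exists b; split=> // i | left=> i]; first lia.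
  by rewrite ltnS leq_eqVlt => /orP[/eqP->|/no].
right; have [Jb|nJb] := boolP (J b).
  by exists b; split=> // i; lia.
exists j; split=> //; first exact: ltnW.
by move=> i /andP[ji]; rewrite ltnS leq_eqVlt => /orP[/eqP->//|ib]; apply: no; rewrite ji.
Qed.

(* The path intersection property for arbitrary sets of faces: only the        *)
(* intervals of colours are assumed in [polytopal].                            *)
Lemma path_intersection (J : pred nat) x y :
  (forall i, (0 < i <= N)%N -> J i -> con (fun l => i != l.+1) x y) ->
  con (fun l => ~~ J l.+1) x y.
Proof.
move=> xyJ.
(* Induction on a bound for the elements of [J] taken into account. *)
suff bound b : con (fun l => ~~ (J l.+1 && (l.+1 < b)%N)) x y.
  by apply: con_sub (bound N.+1) => l lN; rewrite ltnS lN andbT.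
elim: b => [|b IHb]; first by apply: con_sub (pol_con polM x y) => l _ _; rewrite andbF.
have [Jb|nJb] := boolP (J b); last first.
  apply: con_sub IHb => l _; apply: contra => /andP[Jl]; rewrite Jl ltnS leq_eqVlt /=.
  by case/orP=> // /eqP e; rewrite -e Jl in nJb.
have xyb : con (fun l => b != l.+1) x y.
  have [bN|bN] := boolP (0 < b <= N)%N; first exact: xyJ.
  by apply: con_sub (pol_con polM x y) => l lN _; lia.
have [no|[j [jb Jj no]]] := last_before J b.
  apply: con_sub xyb => l lN; apply: contra => /andP[Jl].
  rewrite ltnS leq_eqVlt => /orP[/eqP->//|/no]; by rewrite Jl.
have [|y' xy' y'y] := @con_split_rev _ j _ _ _ IHb.
  by move=> l; apply: contra => /eqP<-; rewrite Jj jb.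
have xy'b : con (fun l => b != l.+1) x y'.
  apply: con_trans xyb _; apply: sym; apply: con_sub y'y => l lN /andP[_ lj]; lia.
(* Here [j] is the last element of [J] before [b]. From [x] to [w] there is a path of colours below
   [b - 1], and through [y'] one of colours at least [j]; the weak property confines both to the
   interval, where no colour is forbidden. *)
have [w xw wy'] := con_split (fun l h => h) xy'b.
have xw' : con (fun l => (j <= l < b.-1)%N) x w.
  apply: (pol_wpip polM); first by apply: con_sub xw => l lN /andP[_]; lia.
  apply: (@con_trans _ _ _ _ y').
    by apply: con_sub xy' => l lN /andP[].
  by apply: sym; apply: con_sub wy' => l lN /andP[_]; lia.
apply: con_trans (con_trans (con_sub _ xw') (con_sub _ wy')) (con_sub _ y'y).
- by move=> l lN h; rewrite negb_and (no l.+1) //; clear -h; lia.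
- by move=> l lN /andP[_ h]; rewrite negb_and; apply/orP; right; clear -h; lia.
- by move=> l lN /andP[+ h]; apply: contra => /andP[-> _]; clear -h jb; lia.
Qed.

Lemma con_all_eq x y : (forall i, (0 < i <= N)%N -> con (fun l => i != l.+1) x y) -> x = y.
Proof.
move=> h; have := @path_intersection predT x y (fun i iN _ => h i iN).
by apply: (@con_ind _ _ _ _ (fun z => x = z)).
Qed.

Lemma con_r_neq l x : (l < N)%N -> ~ con (fun m => l.+1 != m.+1) x (r l x).
Proof.
move=> lN c; apply: (@pol_neq _ _ _ polM l x lN); apply/esym/con_all_eq => i iN.
have [->//|il] := eqVneq i l.+1.
exact: con_r.
Qed.

Definition component i x : {set M} := [set y | con (fun l => i != l.+1) x y].

Lemma component_eq i x y : con (fun l => i != l.+1) x y -> component i x = component i y.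
Proof.
move=> xy; apply/setP => z; rewrite !inE; apply/idP/idP; apply: con_trans => //.
exact: sym.
Qed.

(** A face of height [i] is a component of the graph without colour [i - 1]. For [i = 0] and
    [i = N.+1] no colour is removed and the whole graph gives the minimum and the maximum. The proof
    argument lets the order instance below find the axioms. *)
Definition faceM (_ : polytopal N r) : Type :=
  {p : 'I_N.+2 * {set M} | [exists x, p.2 == component p.1 x]}.
HB.instance Definition _ := Finite.on (faceM polM).
HB.instance Definition _ := SubType.on (faceM polM).

Implicit Types F G H : faceM polM.

Definition idx F : nat := (val F).1.
Definition cell F : {set M} := (val F).2.

Lemma cellP F x : x \in cell F -> cell F = component (idx F) x.
Proof.
have /existsP[y /eqP e] := valP F; rewrite /cell /idx e inE => yx.
exact: component_eq.
Qed.

Lemma cell_con F x y : x \in cell F -> con (fun l => idx F != l.+1) x y -> y \in cell F.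
Proof. by move=> /cellP-> xy; rewrite inE. Qed.

Lemma cell_con2 F x y : x \in cell F -> y \in cell F -> con (fun l => idx F != l.+1) x y.
Proof. by move=> /cellP->; rewrite inE. Qed.

Lemma cell_ex F : exists x, x \in cell F.
Proof.
have /existsP[y /eqP e] := valP F; exists y.
by rewrite /cell e inE con_refl.
Qed.

Lemma idx_lt F : (idx F < N.+2)%N. Proof. exact: ltn_ord. Qed.

Lemma faceM_eq F G x : idx F = idx G -> x \in cell F -> x \in cell G -> F = G.
Proof.
move=> e /cellP eF /cellP eG; apply: val_inj.
rewrite [LHS]surjective_pairing [RHS]surjective_pairing -/(cell F) -/(cell G) eF eG e.
by congr (_, _); apply: val_inj.
Qed.

Definition le_faceM : rel (faceM polM) :=
  fun F G => (idx F <= idx G)%N && (cell F :&: cell G != set0).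

Lemma le_faceM_refl : reflexive le_faceM.
Proof.
move=> F; rewrite /le_faceM leqnn setIid; have [x xF] := cell_ex F.
by apply/set0Pn; exists x.
Qed.

Lemma le_faceM_anti : antisymmetric le_faceM.
Proof.
move=> F G /andP[/andP[FG /set0Pn[x /setIP[xF xG]]] /andP[GF _]].
by apply: (@faceM_eq _ _ x) => //; apply/eqP; rewrite eqn_leq FG.
Qed.

(** A path inside [G] from a flag of [F] to a flag of [H] is sorted with its high colours first:
    these stay in [F], the low ones stay in [H], so the turning point lies in both. *)
Lemma le_faceM_trans : transitive le_faceM.
Proof.
move=> G F H /andP[FG /set0Pn[x /setIP[xF xG]]] /andP[GH /set0Pn[y /setIP[yG yH]]].
rewrite /le_faceM (leq_trans FG) //=; apply/set0Pn.
have [t xt ty] := con_split_rev (fun l h => h) (cell_con2 xG yG).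
exists t; rewrite inE (cell_con xF) 1?(cell_con yH) //.
  by apply: sym; apply: con_sub ty => l lN /andP[_]; lia.
by apply: con_sub xt => l lN /andP[_]; lia.
Qed.

HB.instance Definition _ := Order.Le_isPOrder.Build Order.NatOrder.nat_display
  (faceM polM) le_faceM_refl le_faceM_anti le_faceM_trans.
End Maniplex.

(** * The face poset is a polytope with the given flag graph *)

Section ManiplexPoset.
Context (M : finType) (N : nat) (r : nat -> M -> M) (polM : polytopal N r) (x0 : M).
Implicit Types (x y z : M) (i j k l m : nat) (p q : pred nat).

Notation con := (con r N).
Notation P := (faceM polM).
Implicit Types (F G H : P) (A B : {set P}).

Let sym p x y : con p x y -> con p y x.
Proof. exact: con_symW (pol_rK polM) _ _ _. Qed.

Lemma le_faceE F G : (F <= G) = (idx F <= idx G)%N && (cell F :&: cell G != set0).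
Proof. by []. Qed.

Lemma le_faceP F G :
  reflect ((idx F <= idx G)%N /\ exists2 x, x \in cell F & x \in cell G) (F <= G).
Proof.
rewrite le_faceE; apply: (iffP andP) => -[FG].
  by case/set0Pn=> x /setIP[xF xG]; split=> //; exists x.
by case=> x xF xG; split=> //; apply/set0Pn; exists x; rewrite inE xF.
Qed.

Lemma idx_le F G : F <= G -> (idx F <= idx G)%N.
Proof. by case/le_faceP. Qed.

Lemma idx_inj_le F G : F <= G -> idx F = idx G -> F = G.
Proof. by case/le_faceP=> _ [x xF xG] e; apply: faceM_eq xF xG. Qed.

Lemma idx_ltn F G : F < G -> (idx F < idx G)%N.
Proof.
rewrite lt_neqAle => /andP[ne FG]; rewrite ltn_neqAle idx_le // andbT.
by apply: contraNneq ne => /(idx_inj_le FG) ->.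
Qed.

Lemma lt_idx F G : F <= G -> (F < G) = (idx F < idx G)%N.
Proof.
move=> FG; apply/idP/idP => [/idx_ltn//|lt]; rewrite lt_neqAle FG andbT.
by apply: contraTneq lt => ->; rewrite ltnn.
Qed.

Fact face_of_subproof (i : 'I_N.+2) x : [exists y, component N r i x == component N r i y].
Proof. by apply/existsP; exists x. Qed.

Definition face_of i x : P := exist _ (inord i, component N r (inord i : 'I_N.+2) x)
  (face_of_subproof (inord i) x).

Lemma idx_face_of i x : (i < N.+2)%N -> idx (face_of i x) = i.
Proof. by move=> iN; rewrite /idx /= inordK. Qed.

Lemma cell_face_of i x : (i < N.+2)%N -> cell (face_of i x) = component N r i x.
Proof. by move=> iN; rewrite /cell /= inordK. Qed.

Lemma mem_face_of i x : x \in cell (face_of i x).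
Proof. by rewrite /cell /= inE con_refl. Qed.

Lemma face_of_cell F x : x \in cell F -> face_of (idx F) x = F.
Proof.
by move=> xF; apply: (faceM_eq _ (mem_face_of _ x) xF); rewrite idx_face_of ?idx_lt.
Qed.

Lemma face_of_eq i x y : (i < N.+2)%N ->
  face_of i x = face_of i y <-> con (fun l => i != l.+1) x y.
Proof.
move=> iN; split=> [e|xy]; last first.
  apply: (faceM_eq (x := y)) (mem_face_of _ _) => //.
  by rewrite cell_face_of // inE.
have := mem_face_of i y; rewrite -e cell_face_of // inE.
by [].
Qed.

Lemma face_of_le i j x : (i <= j)%N -> (j < N.+2)%N -> face_of i x <= face_of j x.
Proof.
move=> ij jN; apply/le_faceP; rewrite !idx_face_of //; last exact: leq_ltn_trans ij jN.
by split=> //; exists x; apply: mem_face_of.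
Qed.

Definition flag_at x : {set P} := [set F | x \in cell F].

Lemma chain_flag_at x : chain (flag_at x).
Proof.
apply/chainP => F G; rewrite !inE => xF xG; apply/orP.
by case: (leqP (idx F) (idx G)) => [|/ltnW] h; [left | right]; apply/le_faceP;
  split=> //; exists x.
Qed.

Lemma card_idx_set A : chain A -> #|[set (inord (idx F) : 'I_N.+2) | F in A]| = #|A|.
Proof.
move=> cA; apply: card_in_imset => F G FA GA /(congr1 val) /=.
rewrite !inordK ?idx_lt // => e.
by case/orP: (chainP _ cA F G FA GA) => [|/[dup] _ h]; [|apply/esym; move: h];
  move=> /idx_inj_le ->.
Qed.

Lemma card_flag_at x : #|flag_at x| = N.+2.
Proof.
rewrite -card_idx_set; last exact: chain_flag_at.
rewrite -[RHS]card_ord -cardsT; congr #|pred_of_set _|; apply/setP => i; rewrite inE.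
apply/imsetP; exists (face_of i x); first by rewrite inE mem_face_of.
by rewrite idx_face_of // inord_val.
Qed.

(* The colours below the index of a face commute with those above it, so a     *)
(* flag through a chain can be changed above its top face.                     *)
Lemma chain_common A : chain A -> exists x, A \subset flag_at x.
Proof.
elim: {A}_.+1 {-2}A (ltnSn #|A|) => // s IHs A As cA.
have [->|/set0Pn[F0 F0A]] := eqVneq A set0; first by exists x0; apply: sub0set.
case: (@arg_maxnP _ F0 (fun F => F \in A) (@idx _ _ _ polM) F0A) => F FA Fmax.
have cA' : chain (A :\ F) by apply: chain_sub cA; apply: subD1set.
have [|x xA'] := IHs (A :\ F) _ cA'.
  by move: As; rewrite (cardsD1 F A) FA add1n ltnS.
have AE x' : A :\ F \subset flag_at x' -> x' \in cell F -> A \subset flag_at x'.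
  by move=> s' xF; rewrite -(setD1K FA) subUset sub1set inE xF.
have [e|/set0Pn[G0 G0A]] := eqVneq (A :\ F) set0.
  by have [y yF] := cell_ex F; exists y; apply: AE => //; rewrite e sub0set.
case: (@arg_maxnP _ G0 (fun G => G \in A :\ F) (@idx _ _ _ polM) G0A) => G GA Gmax.
have GF : G <= F.
  have [/= nGF GA1] := setD1P GA; have := chainP _ cA _ _ GA1 FA.
  case/orP=> // FG; rewrite -(idx_inj_le FG) //; apply/eqP.
  by rewrite eqn_leq idx_le //; apply: Fmax.
have [gf [y yG yF]] := le_faceP _ _ GF.
have xG : x \in cell G by move/subsetP: xA' => /(_ G GA); rewrite inE.
(* Colours from [idx G] on keep all faces of [A :\ F], as [G] is the top one among them; the lower
   colours keep [F]. *)
have [t xt ty] := con_split_rev polM (fun l h => h) (cell_con2 xG yG).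
exists t; apply: AE; last first.
  apply: (cell_con yF); apply: sym; apply: con_sub ty => l lN /andP[_ lt].
  by rewrite gtn_eqF // (leq_trans lt gf).
apply/subsetP => H HA; rewrite inE; have := Gmax H HA => HG.
have xH : x \in cell H by move/subsetP: xA' => /(_ H HA); rewrite inE.
apply: (cell_con xH); apply: con_sub xt => l lN /andP[_ gl].
by rewrite ltn_eqF // ltnS (leq_trans HG gl).
Qed.

Lemma flag_flag_at x : flag (flag_at x).
Proof.
apply/maxsetP; split=> [|B cB sB]; first exact: chain_flag_at.
have [y sy] := chain_common cB; apply/eqP; rewrite eq_sym eqEcard sB /=.
by rewrite card_flag_at -(card_flag_at y) subset_leq_card.
Qed.

Lemma flagP A : flag A -> exists x, A = flag_at x.
Proof.
move=> fA; have [x sx] := chain_common (flag_chain fA); exists x.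
by apply/esym/flag_eq_sub => //; apply: chain_flag_at.
Qed.

Lemma height_faceM F : height F = idx F.
Proof.
apply/eqP; rewrite eqn_leq; apply/andP; split.
  apply/bigmax_leqP => A /andP[cA /subsetP AF].
  rewrite -card_idx_set // -[leqRHS](card_ord (idx F)) -[leqRHS]cardsT.
  rewrite -(@card_imset _ _ (widen_ord (ltnW (idx_lt F)))); last first.
    by move=> i j /(congr1 val) /= e; apply: val_inj.
  apply/subset_leq_card/subsetP => _ /imsetP[G GA ->].
  have := AF G GA; rewrite inE => /idx_ltn lt.
  apply/imsetP; exists (Ordinal lt) => //.
  by apply: val_inj; rewrite /= inordK ?idx_lt.
have [x xF] := cell_ex F.
pose B := [set G in flag_at x | (idx G < idx F)%N].
have cB : chain B.
  apply: (chain_sub _ (chain_flag_at x)).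
  by apply/subsetP => G; rewrite inE => /andP[].
have -> : idx F = #|B|.
  rewrite -card_idx_set // -[LHS](card_ord (idx F)) -[LHS]cardsT.
  rewrite -(@card_imset _ _ (widen_ord (ltnW (idx_lt F)))); last first.
    by move=> i j /(congr1 val) /= e; apply: val_inj.
  congr #|pred_of_set _|; apply/setP => i; apply/imsetP/imsetP => -[k].
    move=> _ ->; have kN : (k < N.+2)%N by apply: ltn_trans (idx_lt F).
    exists (face_of k x).
      by rewrite inE idx_face_of // ltn_ord andbT inE mem_face_of.
    by apply: val_inj; rewrite /= idx_face_of // inordK.
  rewrite inE => /andP[xk kF ->]; exists (Ordinal kF) => //.
  by apply: val_inj; rewrite /= inordK ?idx_lt.
apply: (@leq_bigmax_cond _ _ (fun A : {set P} => #|A|)); rewrite cB /=.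
apply/subsetP => G; rewrite !inE => /andP[xG GF].
rewrite lt_idx //; apply/le_faceP; split; [exact: ltnW | by exists x].
Qed.

Lemma flag_at_step l x : (l < N)%N -> flag_at x :\: flag_at (r l x) = [set face_of l.+1 x].
Proof.
move=> lN; apply/setP => F; rewrite !inE; apply/andP/eqP => [[nF xF]|->].
  have [e|ne] := eqVneq (idx F) l.+1.
    by rewrite -e face_of_cell.
  by case/negP: nF; apply: (cell_con xF); apply: con_r.
rewrite mem_face_of cell_face_of ?inE //; last lia.
by split=> //; apply/negP; apply: (con_r_neq polM).
Qed.

Lemma adjacent_flag_at l x : (l < N)%N -> adjacent (flag_at x) (flag_at (r l x)).
Proof.
move=> lN; rewrite /adjacent !flag_flag_at flag_at_step // cards1.
by rewrite -{2}[x](pol_rK polM lN) flag_at_step // cards1.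
Qed.

Lemma polytope_faceM : is_polytope P N.
Proof.
split.
- exists (face_of 0 x0) => G; apply/le_faceP; rewrite idx_face_of //; split=> //.
  have [y yG] := cell_ex G; exists y => //; rewrite cell_face_of // inE.
  by apply: con_sub (pol_con polM _ _).
- exists (face_of N.+1 x0) => G; apply/le_faceP; rewrite idx_face_of //; split.
    by rewrite -ltnS idx_lt.
  have [y yG] := cell_ex G; exists y => //; rewrite cell_face_of // inE.
  by apply: con_sub (pol_con polM _ _) => l lN _; lia.
- by move=> Phi /flagP[x ->]; apply: card_flag_at.
- move=> i F G iN FG rF rG; have hF : idx F = i by rewrite -height_faceM; apply/rank_height.
  have hG : idx G = i.+2.
    by rewrite -height_faceM; apply/rank_height; rewrite rG; lia.
  have [_ [x xF xG]] := le_faceP _ _ (ltW FG).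
  have rK := pol_rK polM iN.
  have between z : z \in cell F -> z \in cell G -> F < face_of i.+1 z < G.
    move=> zF zG; rewrite !lt_idx ?idx_face_of ?hF ?hG ?ltnSn //; do ?lia.
      by apply/le_faceP; rewrite idx_face_of ?hF;
        [split=> //; exists z; rewrite // mem_face_of | lia].
    by apply/le_faceP; rewrite idx_face_of ?hG;
      [split=> //; exists z; rewrite // mem_face_of | lia].
  have -> : [set H | F < H < G] = [set face_of i.+1 x; face_of i.+1 (r i x)].
    apply/setP => H; rewrite !inE; apply/idP/orP => [/andP[FH HG]|[]/eqP->]; last 2 first.
    + exact: between.
    + by apply: between; [apply: (cell_con xF) | apply: (cell_con xG)];
        apply: con_r => //; lia.
    have [z sz] : exists z, [set F; H; G] \subset flag_at z.
      apply: chain_common; rewrite setUC; apply: chain1U (chain2 (ltW FH)) _ => K.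
      by case/set2P=> ->; apply/orP; right; rewrite ltW // (lt_trans FH HG).
    have [zF zH zG] : [/\ z \in cell F, z \in cell H & z \in cell G].
      by split; [have := subsetP sz F | have := subsetP sz H | have := subsetP sz G];
        rewrite !inE eqxx ?orbT; apply.
    have hH : idx H = i.+1.
      have := idx_ltn HG; have := idx_ltn FH; rewrite hF hG ltnS => iH Hi.
      by apply/eqP; rewrite eqn_leq iH Hi.
    have xz : con (fun l => ~~ ((l.+1 == i) || (l.+1 == i.+2))) x z.
      apply: (path_intersection polM (J := fun k => (k == i) || (k == i.+2))).
      move=> k kN /orP[/eqP->|/eqP->].
        by rewrite -hF; apply: cell_con2 xF zF.
      by rewrite -hG; apply: cell_con2 xG zG.
    (* The path from [x] to [z] avoids colours [i - 1] and [i + 1], so colour [i] commutes with the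
       others on it and can be moved to the front, where it occurs once or not at all. *)
    pose q l := ~~ ((l.+1 == i) || (l.+1 == i.+2)) && (l != i).
    have qi : con q x z \/ con q (r i x) z.
      move: xz; apply: (@con_ind _ _ _ _ (fun z => con q x z \/ con q (r i x) z)).
        move=> w l lN ln; have [->|li] := eqVneq l i.
          have comm u v : con q u v -> con q (r i u) (r i v).
            by apply: (con_comm polM) => // m mN; rewrite /q; clear; lia.
          by move=> [/comm|/comm]; rewrite ?rK; [right | left].
        by move=> [h|h]; [left | right]; apply: con_trans h _;
          apply: con_r => //; rewrite /q ln li.
      by left; apply: con_refl.
    have step w : con q w z -> H = face_of i.+1 w.
      move=> wz; rewrite -(face_of_cell zH) hH; apply/face_of_eq; first exact: ltnW.
      by apply: sym; apply: con_sub wz => l lN /andP[_]; rewrite eqSS eq_sym.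
    by case: qi => /step->; [left | right].
  rewrite cards2; case: eqP => //= /face_of_eq => h.
  by case: (con_r_neq polM iN (h _)); lia.
- move=> _ _ /flagP[x ->] /flagP[y ->]; set C := _ :&: _.
  (* [J] is the set of heights at which the two flags have the same face; a path avoiding the
     corresponding colours keeps all common faces. *)
  pose J i := con (fun l => i != l.+1) x y.
  have xy : con (fun l => ~~ J l.+1) x y by apply: (path_intersection polM).
  suff [] : connect (adjacent_through C) (flag_at x) (flag_at y) /\
      con (fun l => ~~ J l.+1) x y by [].
  have inC z : con (fun l => ~~ J l.+1) x z -> C \subset flag_at z.
    move=> xz; apply/subsetP => F; rewrite !inE => /andP[xF yF].
    apply: (cell_con xF); apply: con_sub xz => l lN; apply: contra => /eqP <-.
    exact: cell_con2.
  move: xy; apply: (@con_ind _ _ _ _ (fun z =>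
    connect _ (flag_at x) (flag_at z) /\ con _ x z)).
    move=> z l lN Jl [xz cz].
    have cz' : con (fun l => ~~ J l.+1) x (r l z) by apply: con_trans cz _; apply: con_r.
    split=> //; apply: connect_trans xz _; apply: connect1.
    by rewrite /adjacent_through !inC // adjacent_flag_at.
  by split; [apply: connect0 | apply: con_refl].
Qed.

Definition flagM x : flagT P := exist _ (flag_at x) (flag_flag_at x).

Variable F0 : P.

Lemma face_flagM x i : (i < N.+2)%N -> face F0 (flagM x) i = face_of i x.
Proof.
move=> iN; apply: (face_eq polytope_faceM); last by rewrite height_faceM idx_face_of.
by rewrite inE mem_face_of.
Qed.

(** Flag adjacency in the poset is the given involution, so words act in the same way on both. *)
Lemma fadj_flagM l x : (l < N)%N -> fadj N F0 l (flagM x) = flagM (r l x).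
Proof.
move=> lN; apply: (fadj_eq polytope_faceM); apply/adj_specP; split.
  move=> /(congr1 (fun Phi => face F0 Phi l.+1)); rewrite !face_flagM; do ?lia.
  move=> /face_of_eq h; apply: (con_r_neq polM lN (x := x)).
  by apply: sym; apply: h; lia.
move=> i iN il; rewrite !face_flagM //; apply/face_of_eq => //.
by apply: sym; apply: con_r.
Qed.

Lemma walk_flagM u x : word N predT u -> walk (fadj N F0) (flagM x) u = flagM (walk r x u).
Proof.
by elim: u x => //= l u IHu x /andP[/andP[lN _] wu]; rewrite fadj_flagM ?IHu.
Qed.

Lemma flagM_inj : injective flagM.
Proof.
move=> x y e; apply: (con_all_eq polM) => i iN.
by apply/face_of_eq; [lia | rewrite -!face_flagM ?e //; lia].
Qed.

End ManiplexPoset.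

(** * Moving along a cycle of even length *)

Lemma odd_ordS s (j : 'I_(2 * s)) : odd (ordS j) = ~~ odd j.
Proof. by rewrite /= odd_mod ?oddM. Qed.

Lemma odd_ord_pred s (j : 'I_(2 * s)) : odd (ord_pred j) = ~~ odd j.
Proof. by rewrite -{2}[j]ord_predK odd_ordS negbK. Qed.

Definition turn s (b : bool) (j : 'I_(2 * s)) := if b then ordS j else ord_pred j.

Lemma odd_turn s b (j : 'I_(2 * s)) : odd (turn b j) = ~~ odd j.
Proof. by case: b; rewrite (odd_ordS, odd_ord_pred). Qed.

Lemma turnK s b (j : 'I_(2 * s)) : turn (~~ b) (turn b j) = j.
Proof. by case: b; rewrite /= (ordSK, ord_predK). Qed.

(** * The extension *)

Section Extension.
Context d (K : finPOrderType d) (n s : nat) (polK : is_polytope K n) (t0 : K).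
Implicit Types (Phi Psi : flagT K) (u v : seq nat).

Notation X := (flagT K).
Notation face := (face t0).
Notation fadj := (fadj n t0).
Notation agree := (agree t0).
Notation N := n.+1.

Hypotheses (n3 : (3 <= n)%N) (s0 : (0 < s)%N).
Context (c : X -> bool) (col : K -> bool) (rho : 'I_n -> X -> X) (Phi0 : X).
Hypothesis cS : forall l Phi, (l < n)%N -> c (fadj l Phi) = ~~ c Phi.
Hypothesis c_stab : forall Phi Psi, c Phi = c Psi -> same_stab n t0 Phi Psi.
Hypothesis c_chiral : forall Phi Psi, same_stab n t0 Phi Psi -> c Phi = c Psi.
Hypothesis c0 : c Phi0.
Hypothesis colS : forall Phi, col (face (fadj n.-1 Phi) n) = ~~ col (face Phi n).
Hypothesis rhoP : forall k Phi,
   [/\ face (rho k Phi) n = face Phi n, rho k (rho k Phi) = Phi,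
       forall l, (l.+1 < n)%N -> rho k (fadj l Phi) = fadj l (rho k Phi),
       c (rho k Phi) = ~~ c Phi
     & (agree k Phi Phi0 -> agree k (rho k Phi) (fadj (axis k) Phi0)) /\
       (agree k Phi (fadj (axis k) Phi0) -> agree k (rho k Phi) Phi0)].

(* Copies of the flag graph of K, glued along the facets by the reflections    *)
(* rho k. For each k the 2s copies are arranged in a cycle; the colouring of   *)
(* the facets decides whether a facet is glued to the next or previous copy.   *)
Definition glued : Type := 'I_n * X * 'I_(2 * s).
HB.instance Definition _ := Finite.on glued.
Implicit Types a b : glued.

Definition base a : X := a.1.2.
Definition color a : bool := c (base a).
(** Crossing a facet keeps its colour but changes the parity of the copy, so the direction seen from
    the other side is the opposite one and colour [n] becomes an involution. *)
Definition dir a : bool := col (face (base a) n) (+) odd a.2.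

Definition gadj l a : glued :=
  if l == n then (a.1.1, rho a.1.1 (base a), turn (dir a) a.2)
  else (a.1.1, fadj l (base a), a.2).

Lemma gadj_lt l a : (l < n)%N -> gadj l a = (a.1.1, fadj l (base a), a.2).
Proof. by move=> ln; rewrite /gadj ltn_eqF. Qed.

Lemma gadj_n a : gadj n a = (a.1.1, rho a.1.1 (base a), turn (dir a) a.2).
Proof. by rewrite /gadj eqxx. Qed.

Lemma color_gadj l a : (l < N)%N -> color (gadj l a) = ~~ color a.
Proof.
rewrite ltnS leq_eqVlt => /orP[/eqP->|ln].
  by rewrite gadj_n /color; case: (rhoP a.1.1 (base a)).
by rewrite gadj_lt // /color cS.
Qed.

Lemma dir_gadj l a : (l < N)%N -> dir (gadj l a) = dir a (+) (n.-1 <= l)%N.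
Proof.
rewrite ltnS leq_eqVlt => /orP[/eqP->|ln].
  rewrite gadj_n /dir /= odd_turn /base /=; case: (rhoP a.1.1 a.1.2) => -> _ _ _ _.
  by rewrite leq_pred addbN addbT.
rewrite gadj_lt // /dir /base /=; case: (ltngtP l n.-1) => [lt|lt|->].
- by rewrite face_fadj ?addbF //; lia.
- by exfalso; move: lt ln; clear; lia.
- by rewrite colS addNb addbT.
Qed.

Lemma gadjK l : (l < N)%N -> involutive (gadj l).
Proof.
rewrite ltnS leq_eqVlt => /orP[/eqP->|ln] [[k Phi] j]; last first.
  by rewrite !gadj_lt //= /base /= fadjK.
have := dir_gadj (k, Phi, j) (ltnSn n); rewrite leq_pred addbT.
rewrite [gadj n (gadj n _)]gadj_n => ->; rewrite gadj_n /= turnK /base /=.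
by case: (rhoP k Phi) => _ ->.
Qed.

Lemma gadjC l m a : (l.+1 < m)%N -> (m < N)%N -> gadj l (gadj m a) = gadj m (gadj l a).
Proof.
move=> lm mN; have ln : (l < n)%N by lia.
have [mn|mn] := eqVneq m n; last first.
  have mn' : (m < n)%N by lia.
  by rewrite !gadj_lt //= /base /= fadjC.
have ln1 : (l.+1 < n)%N by rewrite -mn.
rewrite mn !gadj_n !gadj_lt //= /base /=; case: (rhoP a.1.1 a.1.2) => _ _ -> // _ _.
have -> : dir (a.1.1, fadj l a.1.2, a.2) = dir a.
  by rewrite -gadj_lt // dir_gadj ?(ltnW ln) //; case: leqP; rewrite ?addbF //; lia.
by [].
Qed.

(** * The rotary cover of the glued copies *)

Definition white : Type := {a : glued | color a}.
HB.instance Definition _ := Finite.on white.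
HB.instance Definition _ := SubType.on white.

Definition fun_adj l (f : {ffun white -> glued}) := [ffun y => gadj l (f y)].

(* The smallest rotary cover of the glued copies: words in the adjacencies are *)
(* identified when they act in the same way on all white flags.                *)
Definition cover : Type :=
  {f : {ffun white -> glued} | con fun_adj N predT [ffun y => val y] f}.
HB.instance Definition _ := Finite.on cover.
HB.instance Definition _ := SubType.on cover.
Implicit Types x z : cover.

Definition cadj l x : cover := insubd x (fun_adj l (val x)).

Lemma val_cadj l x : (l < N)%N -> val (cadj l x) = fun_adj l (val x).
Proof.
move=> lN; rewrite val_insubd ifT //.
by apply: con_trans (valP x) _; apply: con_r.
Qed.

Definition at_ x (y : white) : glued := val x y.

Lemma cover_eq x z : (forall y, at_ x y = at_ z y) -> x = z.
Proof. by move=> e; apply/val_inj/ffunP. Qed.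

Lemma at_cadj l x y : (l < N)%N -> at_ (cadj l x) y = gadj l (at_ x y).
Proof. by move=> lN; rewrite /at_ val_cadj // ffunE. Qed.

Lemma at_walk u x y : word N predT u ->
  at_ (walk cadj x u) y = walk gadj (at_ x y) u.
Proof.
by elim: u x => //= l u IHu x /andP[/andP[lN _] wu]; rewrite IHu // at_cadj.
Qed.

Fact base_cover_subproof : con fun_adj N predT [ffun y => val y] [ffun y : white => val y].
Proof. exact: con_refl. Qed.

Definition base_cover : cover :=
  exist (fun f => con fun_adj N predT [ffun y => val y] f) _ base_cover_subproof.

Lemma cover_con x z : con cadj N predT x z.
Proof.
have rK l : (l < N)%N -> involutive (cadj l).
  by move=> lN x'; apply: cover_eq => y; rewrite !at_cadj // gadjK.
suff from_base x' : con cadj N predT base_cover x'.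
  by apply: (con_trans _ (from_base z)); apply: con_symW.
have /conP[u wu eu] := valP x'.
apply/conP; exists u => //; apply: val_inj; rewrite -eu.
have val_walk : forall u x1, word N predT u -> val (walk cadj x1 u) = walk fun_adj (val x1) u.
  by elim=> //= l v IHv x1 /andP[/andP[lN _] wv]; rewrite IHv // val_cadj.
exact: val_walk.
Qed.

Lemma cover_word x : exists2 u, word N predT u & forall y, at_ x y = walk gadj (val y) u.
Proof.
have /conP[u wu <-] := cover_con base_cover x; exists u => // y.
by rewrite at_walk // /at_ /= ffunE.
Qed.

Lemma color_walk u a : word N predT u -> color (walk gadj a u) = color a (+) odd (size u).
Proof.
elim: u a => [|l u IHu] a /=; first by rewrite addbF.
by move=> /andP[/andP[lN _] wu]; rewrite IHu // color_gadj // addbN addNb.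
Qed.

Definition index0 : 'I_n := Ordinal (ltnW (ltnW n3)).

Fact copies_gt0 : (0 < 2 * s)%N. Proof. by rewrite muln_gt0. Qed.
Definition copy0 : 'I_(2 * s) := Ordinal copies_gt0.

Definition white0 : white := exist _ (index0, Phi0, copy0) c0.

Definition parity x := color (at_ x white0).

Lemma color_at x y : color (at_ x y) = parity x.
Proof.
have [u wu eu] := cover_word x; rewrite /parity !eu !color_walk //.
by rewrite (valP y) (valP white0).
Qed.

Lemma parity_cadj l x : (l < N)%N -> parity (cadj l x) = ~~ parity x.
Proof. by move=> lN; rewrite /parity at_cadj // color_gadj. Qed.

(** A word acts as a permutation of the glued flags and shifts colours uniformly, so it carries the
    white flags onto all flags of one colour. *)
Lemma at_surj x a : color a = parity x -> exists y, at_ x y = a.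
Proof.
have [u wu eu] := cover_word x; move=> ca.
have wh : color (walk gadj a (rev u)).
  rewrite color_walk ?word_rev // size_rev ca -(color_at x white0) eu color_walk //.
  by rewrite (valP white0) addTb addNb addbb.
exists (exist (fun b => is_true (color b)) _ wh).
rewrite eu /= -{2}[u]revK (walk_rev gadjK) ?word_rev //.
Qed.

Lemma walk_gadj a u : word n predT u ->
  walk gadj a u = (a.1.1, walk fadj (base a) u, a.2).
Proof.
elim: u a => [|l u IHu] [[k Phi] j] //= /andP[/andP[ln _] wu].
by rewrite gadj_lt // IHu.
Qed.

Lemma word_leq m (p : pred nat) u : (m <= N)%N -> word m p u -> word N p u.
Proof. by move=> mN; apply: sub_all => l /andP[lm ->]; rewrite (leq_trans lm). Qed.

(** Colours below [n] act on every coordinate inside a copy of K. All coordinates of [x] have the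
    same colour, hence the same stabilizer, so one flag of that colour decides for all of them. *)
Lemma walk_lift x u v Phi : c Phi = parity x -> word n predT u -> word n predT v ->
  walk fadj Phi u = walk fadj Phi v -> walk cadj x u = walk cadj x v.
Proof.
move=> cx wu wv e; apply: cover_eq => y.
rewrite !at_walk ?(word_leq (leqnSn n)) // !walk_gadj //; congr (_, _, _).
apply: (c_stab _ _ _).1 e => //.
by rewrite cx -(color_at x y).
Qed.

(** Every coordinate of [z] occurs as a coordinate of [x]. This gives the cover an automorphism
    between any two flags of equal parity. *)
Lemma same_parity x z u v : parity x = parity z -> word N predT u -> word N predT v ->
  walk cadj x u = walk cadj x v -> walk cadj z u = walk cadj z v.
Proof.
move=> xz wu wv e; apply: cover_eq => y.
have [y' ey'] : exists y', at_ x y' = at_ z y by apply: at_surj; rewrite color_at.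
by rewrite !at_walk // -ey' -!at_walk // e.
Qed.

(** Only the path intersection property needs work. For 0 < k < n and m <= n the two paths are
    compared at a coordinate in the [k]-th cycle of copies, where they force agreement with [Phi0]
    in ranks < k; the conclusion then comes from K. *)
Lemma polytopal_cover : polytopal N cadj.
Proof.
split.
- by move=> l lN x; apply: cover_eq => y; rewrite !at_cadj // gadjK.
- move=> l m x lm mN; have lN : (l < N)%N by apply: ltn_trans mN; apply: ltnW.
  by apply: cover_eq => y; rewrite !at_cadj // gadjC.
- by move=> l x lN /(congr1 parity); rewrite parity_cadj //; case: parity.
- exact: cover_con.
move=> k m x z xzm xzk.
have [nm|mn] := ltnP n m.
  by apply: con_sub xzk => l lN ->; rewrite (leq_trans lN).
have [->|k0] := posnP k; first exact: xzm.
have [nk|kn] := leqP n k.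
  have [->|e] : z = x \/ z = cadj n x.
    move: xzk; apply: (@con_ind _ _ _ _ (fun z => z = x \/ z = cadj n x)); last by left.
    move=> w l lN kl.
    have -> : l = n by apply/eqP; rewrite eqn_leq -ltnS lN (leq_trans nk).
    case=> ->; [by right | left].
    by apply: cover_eq => y; rewrite !at_cadj // gadjK.
    exact: con_refl.
  (* For [k >= n] the second path uses colour [n] alone. The first path stays in its copy, while
     colour [n] changes the parity of the copy, so [z] must be [x]. *)
  have same_copy : (at_ z white0).2 = (at_ x white0).2.
    move: xzm; apply: (@con_ind _ _ _ _ (fun z => (at_ z white0).2 = (at_ x white0).2)) => //.
    move=> w l lN lm <-; rewrite at_cadj // gadj_lt //.
    exact: leq_trans lm mn.
  move: same_copy; rewrite e at_cadj // gadj_n /= => /(congr1 (fun j => odd (nat_of_ord j))).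
  by rewrite odd_turn; case: odd.
have /conP[u wu eu] := xzm.
have wun : word n predT u.
  by apply: sub_all wu => l /andP[_ lm]; rewrite (leq_trans lm).
(* [Phi] needs the colour prescribed by the parity of [x] and the faces of [Phi0] of rank < k;
   changing the face of rank [k] if necessary achieves both. *)
pose kk := Ordinal kn; pose Phi := if parity x then Phi0 else fadj k Phi0.
have cPhi : c Phi = parity x by rewrite /Phi; case: parity => //; rewrite cS // c0.
have agPhi : agree k Phi Phi0.
  rewrite /Phi; case: parity; first by apply/agreeP.
  by apply/agreeP => i ik; rewrite face_fadj //;
    [apply: leq_ltn_trans ik (leq_trans kn (leqW (leqnSn n))) | rewrite ltn_eqF].
have [y ey] : exists y, at_ x y = (kk, Phi, copy0) by apply: at_surj.
(* Invariant along colours at least [k]: the faces of rank < k are those of [Phi0] in even copies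
   and those of its mirror neighbour in odd ones. As the other path never leaves copy 0, the end
   flag agrees with [Phi0]. *)
pose goodc (j : nat) := if odd j then fadj (axis k) Phi0 else Phi0.
have ez : at_ z y = (kk, walk fadj Phi u, copy0).
  by rewrite -eu at_walk ?ey ?walk_gadj // (word_leq (leqnSn n)).
have [_ agz] : (at_ z y).1.1 = kk /\ agree k (base (at_ z y)) (goodc (at_ z y).2).
  move: xzk; apply: (@con_ind _ _ _ _ (fun z => (at_ z y).1.1 = kk /\
    agree k (base (at_ z y)) (goodc (at_ z y).2))); last by rewrite ey.
  move=> w l lN kl [ek ag]; rewrite at_cadj //.
  have [ln|nl] := ltnP l n.
    rewrite gadj_lt // ek /base /=; split=> //.
    apply: agree_trans ag; apply/agreeP => i ik.
    rewrite face_fadj //; first by apply: leq_ltn_trans ik (leq_trans kn (leqW (leqnSn n))).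
    by rewrite ltn_eqF // ltnS (leq_trans ik).
  have -> : l = n by apply/eqP; rewrite eqn_leq -ltnS lN.
  rewrite gadj_n ek /base /= /goodc odd_turn; split=> //.
  have [_ _ _ _ [ag1 ag2]] := rhoP kk (base (at_ w y)).
  by move: ag; rewrite /goodc; case: odd => /=.
have {}agz : agree k Phi (walk fadj Phi u).
  by apply: (agree_trans agPhi); rewrite agree_sym; move: agz; rewrite ez.
(* In K the two flags agree in ranks < k, and in ranks from [m] on because [u] only has colours
   below [m]. *)
have /conP[v wv ev] : con fadj n (fun l => (k <= l < m)%N) Phi (walk fadj Phi u).
  apply: con_sub (agree_con polK agz) => l ln /andP[-> ne] /=.
  rewrite ltnNge; apply: contra ne => ml; apply/eqP/esym.
  apply: (con_face polK (p := fun l => (l < m)%N)); first exact: ltnW.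
    by move=> l' _ l'm; rewrite eqSS gtn_eqF // (leq_trans l'm).
  apply/conP; exists u => //; apply: sub_all wu => l' /andP[_ l'm].
  by rewrite l'm (leq_trans l'm).
apply/conP; exists v; first exact: word_leq wv.
rewrite -eu; apply: (walk_lift cPhi) => //.
exact: word_sub wv.
Qed.

(** * Facets and chirality of the extension *)

Notation P := (faceM polytopal_cover).
Implicit Types F G H : P.

Lemma polytope_P : is_polytope P N.
Proof. exact: polytope_faceM base_cover. Qed.

Definition pi_ x : X := base (at_ x white0).

Lemma c_pi x : c (pi_ x) = parity x. Proof. by []. Qed.

Lemma pi_walk x u : word n predT u -> pi_ (walk cadj x u) = walk fadj (pi_ x) u.
Proof. by move=> wu; rewrite /pi_ at_walk ?(word_leq (leqnSn n)) // walk_gadj. Qed.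

(** Projection to a single coordinate loses nothing for words in colours below [n]: this identifies
    the flag graph of a facet of the extension with that of K. *)
Lemma pi_walk_eq x u v : word n predT u -> word n predT v ->
  walk cadj x u = walk cadj x v <-> walk fadj (pi_ x) u = walk fadj (pi_ x) v.
Proof.
move=> wu wv; split=> [e|e]; first by rewrite -!pi_walk ?e.
exact: (walk_lift (c_pi x)).
Qed.

Lemma con_pi (p : pred nat) x z : (forall l, p l -> l != n) -> con cadj N p x z ->
  exists2 u, word n p u & walk cadj x u = z.
Proof.
move=> pn /conP[u wu <-]; exists u => //; apply: sub_all wu => l /andP[lN pl].
by rewrite pl andbT ltn_neqAle pn.
Qed.

(** Faces below [F] and faces of K are both indexed by a height and a word in colours below [n]; on
    each side incidence is expressed by equalities of such words, which [pi_walk_eq] transfers. *)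
Lemma facet_P F : facet N F -> isomorphic (face_section F) K.
Proof.
move=> rF; have hF : idx F = N by rewrite -height_faceM; apply/rank_height.
have [x xF] := cell_ex F.
pose f (iu : nat * seq nat) : face_section F :=
  insubd (exist (fun H => H <= F) F (lexx F))
    (face_of polytopal_cover iu.1 (walk cadj x iu.2)).
pose f_ i u := face_of polytopal_cover i (walk cadj x u).
pose g (iu : nat * seq nat) := face (walk fadj (pi_ x) iu.2) iu.1.
have idx_f i u : (i < n.+2)%N -> idx (f_ i u) = i.
  by move=> iN; apply/idx_face_of/leqW.
have walk_in u : word n predT u -> walk cadj x u \in cell F.
  move=> wu; apply: (cell_con xF); apply/conP; exists u => //.
  by apply: sub_all wu => l /andP[ln _]; rewrite hF ltnW // eqSS gtn_eqF.
have fE i u : (i < n.+2)%N -> word n predT u ->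
    val (f (i, u)) = f_ i u.
  move=> iN wu; rewrite val_insubd ifT //; apply/le_faceP.
  rewrite idx_f // hF.
  by split=> //; exists (walk cadj x u); rewrite ?mem_face_of ?walk_in.
have walk_to i u w : (i < n.+2)%N -> word n predT u -> w \in cell (f_ i u) ->
    w \in cell F -> exists2 t, word n (fun l => i != l.+1) t &
    walk cadj (walk cadj x u) t = w.
  move=> iN wu wA wF.
  have : con cadj N (fun l => ~~ ((l.+1 == i) || (l.+1 == N))) (walk cadj x u) w.
    (* Both flags lie in [F] and in the face of height [i], so they are joined by a path avoiding
       colours [n] and [i - 1] simultaneously. *)
    apply: (path_intersection polytopal_cover (J := fun k => (k == i) || (k == N))).
    move=> k _ /orP[/eqP->|/eqP->].
      by have := cell_con2 (mem_face_of _ i _) wA; rewrite idx_f.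
    by have := cell_con2 (walk_in _ wu) wF; rewrite hF.
  case/con_pi=> [l|t wt et]; first by rewrite negb_or => /andP[_].
  by exists t => //; apply: word_sub wt => l; rewrite -topredE /= negb_or eq_sym => /andP[].
have [h [hb hle _]] : exists h : face_section F -> K, [/\ bijective h,
   forall G1 G2 : face_section F, (h G1 <= h G2) = (G1 <= G2)
   & forall iu, (iu.1 < n.+2)%N && word n predT iu.2 -> h (f iu) = g iu].
  apply: indexed_iso.
  - move=> H; have [HF [z zH zF]] := le_faceP _ _ (valP H).
    have := cell_con2 xF zF; rewrite hF => /con_pi[l|u wu eu].
      by rewrite eqSS eq_sym.
    have wu' : word n predT u by apply: word_sub wu.
    have iN : (idx (val H) < n.+2)%N by have := HF; rewrite hF.
    exists (idx (val H), u); first by rewrite /= iN.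
    by apply: val_inj; rewrite fE // /f_ eu face_of_cell.
  - by move=> G; apply: (walk_face_surj polK).
  - move=> [i u] [j v] /andP[/= iN wu] /andP[/= jN wv].
    rewrite leEsub !fE // /g; apply/idP/idP.
      move=> le_ij; apply/(face_le_words polK) => //; split.
        by have := idx_le le_ij; rewrite !idx_f.
      have [w sw] : exists w, [set f_ i u; f_ j v; F] \subset flag_at polytopal_cover w.
        apply: (chain_common base_cover); rewrite setUC.
        apply: chain1U (chain2 le_ij) _ => H /set2P[]->; apply/orP; right;
        by rewrite -fE //; apply: (valP (f _)).
      have wF : w \in cell F by have := subsetP sw F; rewrite !inE eqxx ?orbT; apply.
      have [|t wt et] := walk_to i u w iN wu _ wF.
        by have := subsetP sw (f_ i u); rewrite !inE eqxx ?orbT; apply.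
      have [|t' wt' et'] := walk_to j v w jN wv _ wF.
        by have := subsetP sw (f_ j v); rewrite !inE eqxx ?orbT; apply.
      exists t, t'; split=> //; apply/pi_walk_eq;
        rewrite ?word_cat ?wu ?wv ?walk_cat ?et ?et' //;
        by [apply: word_sub wt | apply: word_sub wt'].
    move/(face_le_words polK) => /(_ wu wv iN jN)[ij [t [t' [wt wt']]]].
    have wT k u' : word n (fun l => k != l.+1) u' -> word n predT u' by apply: word_sub.
    move/pi_walk_eq; rewrite !word_cat wu wv (wT _ _ wt) (wT _ _ wt') => /(_ isT isT).
    rewrite !walk_cat => e; apply/le_faceP; rewrite !idx_f //.
    split=> //; exists (walk cadj (walk cadj x u) t).
      apply: (cell_con (mem_face_of _ _ _)); rewrite idx_f //.
      by apply/conP; exists t => //; apply: word_leq wt.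
    rewrite e; apply: (cell_con (mem_face_of _ _ _)); rewrite idx_f //.
    by apply/conP; exists t' => //; apply: word_leq wt'.
by exists h.
Qed.

(** Equal parity gives equal stabilizers by the construction of the cover. Conversely, restricting
    to words in colours below [n] projects to flags of K, which must then have the same colour by
    chirality of K. *)
Lemma same_stab_flagM (F0 : P) x z : same_stab N F0 (flagM polytopal_cover base_cover x)
  (flagM polytopal_cover base_cover z) <-> parity x = parity z.
Proof.
split=> [st|xz u v wu wv]; last first.
  rewrite !walk_flagM //; split=> /(flagM_inj F0) e; congr flagM;
    [exact: (same_parity xz wu wv e) | exact: (same_parity (esym xz) wu wv e)].
rewrite -!c_pi; apply: c_chiral => u v wu wv.
rewrite -!pi_walk_eq //; have := st u v (word_leq (leqnSn n) wu) (word_leq (leqnSn n) wv).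
rewrite !walk_flagM ?(word_leq (leqnSn n)) //; case=> h1 h2.
by split=> e; apply: (flagM_inj F0 (x0 := base_cover)); [apply: h1 | apply: h2]; rewrite e.
Qed.

Lemma chiral_P : is_chiral P.
Proof.
pose fl x := flagM polytopal_cover base_cover x.
pose F0 := face_of polytopal_cover 0 base_cover.
pose orb (A : {set P}) := orbit 'P^* (poset_aut P) A.
have orbE x z :
    orb (flag_at polytopal_cover x) = orb (flag_at polytopal_cover z) <->
    parity x = parity z.
  rewrite -(same_stab_flagM F0).
  split.
    case/(orbit_flagP polytope_P (fl x) (fl z)) => g gA e.
    by have := aut_same_stab polytope_P F0 (fl x) gA; rewrite e.
  by move/(same_stab_aut polytope_P)/(orbit_flagP polytope_P).
have adjE A B : adjacent A B -> exists x l, [/\ (l < N)%N,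
    A = flag_at polytopal_cover x & B = flag_at polytopal_cover (cadj l x)].
  move=> ad; have /and4P[fA fB _ _] := ad.
  have [x ex] := flagP base_cover fA; have [z ez] := flagP base_cover fB.
  have : adjacent (val (fl x)) (val (fl z)) by rewrite /= -ex -ez.
  move/(adjacent_fadj polytope_P F0) => [l lN].
  rewrite fadj_flagM // => /(congr1 val) /= e.
  by exists x, l; rewrite ez e.
split; last first.
  move=> A B /adjE[x [l [lN -> ->]]]; apply/eqP => /orbE.
  by rewrite parity_cadj //; case: parity.
have -> : [set orb A | A in flags P] =
    [set orb (flag_at polytopal_cover base_cover);
      orb (flag_at polytopal_cover (cadj 0 base_cover))].
  apply/setP => O; rewrite !inE; apply/imsetP/orP => [[A]|].
    rewrite inE => /(flagP base_cover)[x ->] ->.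
    have [e|ne] := eqVneq (parity x) (parity base_cover); [left|right]; apply/eqP/orbE => //.
    by rewrite parity_cadj //; move: ne; case: parity; case: parity.
  have flM x : flag_at polytopal_cover x \in flags P.
    by rewrite inE; apply: (flag_flag_at _ base_cover).
  by case=> /eqP->; [exists (flag_at polytopal_cover base_cover)
    | exists (flag_at polytopal_cover (cadj 0 base_cover))].
rewrite cards2; case: eqP => // /orbE; rewrite parity_cadj //; by case: parity.
Qed.

(** * The last entry of the Schlaefli symbol *)

Definition dirM x := dir (at_ x white0).
Definition copy x := (at_ x white0).2.
(** The flags of the section from a fixed (n-2)-face to the maximum, reached in colours [n - 1] and
    [n]. Both colours flip [dirM], so [half_digon] takes every second flag of this cycle. *)
Definition digon : {set cover} := [set z | con cadj N (fun l => (n.-1 <= l)%N) base_cover z].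
Definition half_digon := [set z in digon | dirM z].

Lemma dirM_cadj l x : (l < N)%N -> dirM (cadj l x) = dirM x (+) (n.-1 <= l)%N.
Proof. by move=> lN; rewrite /dirM at_cadj // dir_gadj. Qed.

Lemma digon_cadj l x : (n.-1 <= l < N)%N -> x \in digon -> cadj l x \in digon.
Proof.
by rewrite !inE => /andP[nl lN] h; apply: con_trans h _; apply: con_r.
Qed.

Lemma cadjK l : (l < N)%N -> involutive (cadj l).
Proof. exact: (pol_rK polytopal_cover). Qed.

(** Colour [n - 1] turns the direction [true] into [false], so the following colour [n] always steps
    back by one copy. *)
Lemma half_digon_shift x : x \in half_digon -> cadj n (cadj n.-1 x) \in half_digon /\
  copy (cadj n (cadj n.-1 x)) = ord_pred (copy x).
Proof.
have n1N : (n.-1 < N)%N by lia.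
rewrite inE => /andP[xO dx]; split; last first.
  rewrite /copy at_cadj // gadj_n /=.
  have -> : dir (at_ (cadj n.-1 x) white0) = false.
    by have := dirM_cadj x n1N; rewrite dx leqnn /dirM => ->.
  by rewrite /turn at_cadj // gadj_lt //; lia.
rewrite inE !dirM_cadj // dx leqnn leq_pred !addbT andbT.
by do 2![apply: digon_cadj; first by rewrite ?leqnn ?leq_pred].
Qed.

Lemma half_digon_unshift x : x \in half_digon -> cadj n.-1 (cadj n x) \in half_digon.
Proof.
have n1N : (n.-1 < N)%N by lia.
rewrite inE => /andP[xO dx].
rewrite inE !dirM_cadj // dx leqnn leq_pred !addbT andbT.
by do 2![apply: digon_cadj; first by rewrite ?leqnn ?leq_pred].
Qed.

(** The rotation gives bijections between the fibres of [copy] over consecutive copies, so all 2s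
    fibres have the same size. *)
Lemma card_half_digon : (2 * s %| #|half_digon|)%N.
Proof.
have n1N : (n.-1 < N)%N by lia.
pose A j := [set z in half_digon | copy z == j].
have cardA j : #|A (ord_pred j)| = #|A j|.
  have <- : [set cadj n (cadj n.-1 z) | z in A j] = A (ord_pred j).
    apply/setP => z; apply/imsetP/idP => [[w]|].
      rewrite inE => /andP[wO /eqP <-] ->; rewrite inE.
      by have [-> ->] := half_digon_shift wO; rewrite eqxx.
    rewrite inE => /andP[zO /eqP ez]; have wO := half_digon_unshift zO.
    have zE : z = cadj n (cadj n.-1 (cadj n.-1 (cadj n z))) by rewrite !cadjK.
    exists (cadj n.-1 (cadj n z)) => //; rewrite inE wO /=; apply/eqP/ord_pred_inj.
    by rewrite -ez {2}zE; have [_ ->] := half_digon_shift wO.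
  by apply: card_imset => z w /(can_inj (cadjK (ltnSn n)))/(can_inj (cadjK n1N)).
have A0 m (mS : (m < 2 * s)%N) : #|A (Ordinal mS)| = #|A copy0|.
  elim: m mS => [|m IHm] mS; first by congr #|pred_of_set (A _)|; apply: val_inj.
  rewrite -(IHm (ltnW mS)) -cardA; congr #|pred_of_set (A _)|; apply: val_inj => /=.
  by rewrite ?addSn /= modnDr modn_small // ltnW.
rewrite -sum1_card (partition_big copy predT) //=.
rewrite (eq_bigr (fun=> #|A copy0|)); first by rewrite sum_nat_const card_ord dvdn_mulr.
by case=> m mS _; rewrite sum1dep_card -(A0 m mS); apply: eq_card => z; rewrite !inE.
Qed.

Lemma half_digon_inj l x z : (n.-1 <= l < N)%N -> x \in half_digon -> z \in half_digon ->
  con cadj N (fun m => m == l) x z -> x = z.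
Proof.
move=> /andP[nl lN]; rewrite !inE => /andP[_ dx] /andP[_ dz] xz.
have : z = x \/ z = cadj l x; last first.
  by case=> // e; move: dz; rewrite e dirM_cadj // dx nl.
move: xz {dz}; apply: (@con_ind _ _ _ _ (fun z => z = x \/ z = cadj l x)); last by left.
by move=> w m _ /eqP-> [->|->]; [right | left; rewrite cadjK].
Qed.

(** Besides its least and greatest elements the section has the faces of heights [n] and [n.+1].
    Each of these contains two flags of the cycle, exactly one of them in [half_digon]. *)
Lemma card_digon_section (F := face_of polytopal_cover n.-1 base_cover)
    (G := face_of polytopal_cover n.+2 base_cover) :
  #|[set H | F <= H <= G]| = (2 * #|half_digon|).+2.
Proof.
have n1 : n.-1.+1 = n by lia.
have n1N : (n.-1 < N)%N by lia.
have idxF : idx F = n.-1 by apply: idx_face_of; lia.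
have idxG : idx G = n.+2 by apply: idx_face_of.
have leG H : H <= G.
  have [y yH] := cell_ex H; apply/le_faceP; rewrite idxG -ltnS idx_lt; split=> //.
  exists y => //; rewrite cell_face_of // inE.
  by apply: con_sub (cover_con _ _) => l lN _; rewrite gtn_eqF.
pose B k := [set face_of polytopal_cover k z | z in half_digon].
have idxB k H : (k < N.+2)%N -> H \in B k -> idx H = k.
  by move=> kN /imsetP[z _ ->]; apply: idx_face_of.
(* For [k = n] the only colour that keeps the face is [l = n], for [k = n.+1] it is [l = n.-1]; it
   flips [dirM], so flags of [half_digon] have distinct faces of height [k]. *)
have cardB k l : (k < N.+2)%N -> (n.-1 <= l < N)%N ->
    (forall m, (m < N)%N -> (n.-1 <= m)%N -> k != m.+1 -> m = l) -> #|B k| = #|half_digon|.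
  move=> kN ln kl; apply: card_in_imset => x z xO zO /face_of_eq xz.
  apply: (half_digon_inj ln xO zO).
  have xz' : con cadj N (fun l => (n.-1 <= l)%N) x z.
    move: xO zO; rewrite !inE => /andP[+ _] /andP[zO _] => xO.
    by apply: con_trans zO; apply: con_symW xO; apply: cadjK.
  have : con cadj N (fun l => ~~ ((l.+1 < n)%N || (l.+1 == k))) x z.
    apply: (path_intersection polytopal_cover (J := fun i => (i < n)%N || (i == k))).
    move=> i _ /orP[lt|/eqP->]; last exact: xz.
    by apply: con_sub xz' => m _ nm; rewrite ltn_eqF // (leq_trans lt) // -n1 ltnS.
  apply: con_sub => m mN; rewrite negb_or -leqNgt -n1 ltnS => /andP[nm mk].
  by apply/eqP/kl; rewrite // eq_sym.
have memB k l H : (n.-1 <= l < N)%N -> (n <= k)%N -> k != l.+1 ->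
    F <= H -> idx H = k -> H \in B k.
  move=> ln nk kl /le_faceP[_ [w wF wH]] eH.
  have : con cadj N (fun l => n.-1 != l.+1) base_cover w.
    by rewrite -idxF; apply: cell_con2 wF; apply: mem_face_of.
  case/(con_split_rev polytopal_cover (fun l h => h)) => z xz zw.
  have zO : z \in digon by rewrite inE; apply: con_sub xz => m _ /andP[].
  have zH : z \in cell H.
    apply: (cell_con wH); apply: (con_symW cadjK); apply: con_sub zw => m _ /andP[_ mn].
    by rewrite eH gtn_eqF // (leq_trans mn) // (leq_trans (leq_pred n)).
  (* If [z] has the wrong direction, its neighbour of colour [l] has the right one and the same face
     of height [k]. *)
  have [dz|dz] := boolP (dirM z).
    apply/imsetP; exists z; first by rewrite inE zO dz.
    by rewrite -eH face_of_cell.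
  have lN : (l < N)%N by case/andP: ln.
  apply/imsetP; exists (cadj l z).
    rewrite inE dirM_cadj // (negbTE dz) digon_cadj //=; by case/andP: ln.
  by rewrite -eH face_of_cell //; apply: (cell_con zH); apply: con_r; rewrite // eH.
have -> : [set H | F <= H <= G] = [set F; G] :|: (B n :|: B n.+1).
  apply/setP => H; rewrite [LHS]inE leG andbT in_setU (in_setU _ (B n)).
  apply/idP/idP => [FH|].
    have := idx_le FH; have := idx_lt H; rewrite idxF => Hn nH.
    have [e|e1] := eqVneq (idx H) n.-1.
      by rewrite (idx_inj_le FH) ?idxF ?e // !inE eqxx.
    have [e|e2] := eqVneq (idx H) n.+2.
      by rewrite (idx_inj_le (leG H)) ?idxG ?e // !inE eqxx orbT.
    have [e|e3] := eqVneq (idx H) n.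
      by rewrite (memB n n) ?orbT // ?leq_pred ?ltnSn //; lia.
    have e : idx H = n.+1 by move: Hn nH e1 e2 e3; clear; lia.
    by rewrite (memB n.+1 n.-1) ?orbT // ?leqnn //; lia.
  have FB k z : (n.-1 <= k < N.+2)%N -> z \in half_digon -> F <= face_of polytopal_cover k z.
    move=> /andP[nk kN]; rewrite !inE => /andP[xz _]; apply/le_faceP.
    rewrite idxF idx_face_of //; split=> //; exists z; rewrite ?mem_face_of //.
    rewrite cell_face_of ?inE; last lia.
    by apply: con_sub xz => l _ nl; rewrite ltn_eqF // ltnS.
  case/orP=> [/set2P[]->//|/orP[]/imsetP[z zO ->]]; apply: FB => //; lia.
rewrite cardsU (cardsU (B n)) (cardB n n) ?(cardB n.+1 n.-1)
  ?leq_pred ?leqnn ?n1N ?ltnSn //; try lia.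
have -> : B n :&: B n.+1 = set0.
  apply/setP => H; rewrite !inE; apply/negP => /andP[/idxB e /idxB e'].
  by move: e e'; lia.
have -> : [set F; G] :&: (B n :|: B n.+1) = set0.
  apply/setP => H; rewrite !inE; apply/negP => /andP[/orP[]/eqP-> /orP[]/idxB];
  rewrite ?idxF ?idxG; lia.
rewrite cards2 !cards0 !subn0; have -> : F != G by apply/eqP => /(congr1 (@idx _ _ _ _)); lia.
by lia.
Qed.

(** A p-gon has 2p + 2 faces, so comparing cardinalities makes [p n] the size of [half_digon]. *)
Lemma type_P p : has_type P N p -> (2 * s %| p n)%N.
Proof.
move=> /(_ n)[|_]; first by lia.
move=> /(_ (face_of polytopal_cover n.-1 base_cover)
  (face_of polytopal_cover n.+2 base_cover)).
have lt1 : (n.-1 < N.+2)%N by lia.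
case.
- by apply: face_of_le; lia.
- by have -> : (n%:Z - 2 = n.-1%:Z - 1)%R by [lia];
    apply/rank_height; rewrite height_faceM idx_face_of.
- by have -> : (n%:Z + 1 = n.+2%:Z - 1)%R by [lia];
    apply/rank_height; rewrite height_faceM idx_face_of.
set S := section _ _ => f fb _.
pose enc (x : polygon_face (p n)) : option (option ('I_(p n) + 'I_(p n))) :=
  match x with PolygonMin => None | PolygonMax => Some None
  | PolygonVertex i => Some (Some (inl i)) | PolygonEdge i => Some (Some (inr i)) end.
have encb : bijective enc.
  exists (fun y => match y with None => PolygonMin _ | Some None => PolygonMax _
    | Some (Some (inl i)) => PolygonVertex i | Some (Some (inr i)) => PolygonEdge i end).
    by case.
  by case=> [[[]|]|].
have := bij_eq_card (bij_comp encb fb); rewrite !card_option card_sum card_ord.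
rewrite -cardsT -(card_imset _ val_inj).
have -> : [set val h | h in [set: S]] = [set H | face_of polytopal_cover n.-1 base_cover
    <= H <= face_of polytopal_cover n.+2 base_cover].
  apply/setP => H; rewrite inE; apply/imsetP/idP => [[h _ ->]|HS]; first exact: (valP h).
  by exists (exist _ H HS : S).
rewrite card_digon_section => e.
have -> : p n = #|half_digon| by lia.
exact: card_half_digon.
Qed.

End Extension.

Theorem theorem3p1 (n : nat) (dK : Order.disp_t) (K : finPOrderType dK)
    (s : nat) :
  (3 <= n)%N ->
  is_polytope K n ->
  dually_bipartite K n ->
  is_chiral K ->
  (forall F : K, facet n F -> is_regular (face_section F)) ->
  (0 < s)%N ->
  exists (dP : Order.disp_t) (P : finPOrderType dP),
    is_extension P K n /\
    is_chiral P /\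
    (forall p : nat -> nat, has_type P n.+1 p -> (2 * s %| p n)%N).
Proof.
move=> n3 polK [col colP] chK regK s0.
have [t0 _] := polytope_min polK.
have [c [cS c_stab c_chiral]] := chiral_color polK t0 chK.
have [Phi0 c0] : exists Phi, c Phi.
  have [Phi _] := exists_flag t0; have [cPhi|cPhi] := boolP (c Phi); first by exists Phi.
  by exists (fadj n t0 0 Phi); rewrite cS // (leq_trans _ n3).
have regF (F : K) : height F = n -> is_regular (face_section F).
  by move=> hF; apply: regK; apply/rank_height.
(* Colour [n - 1] moves to a different facet through the same (n-2)-face, to which the bipartite
   colouring applies. *)
have colS Phi : col (face t0 (fadj n t0 n.-1 Phi) n) = ~~ col (face t0 Phi n).
  have n1 : n.-1.+1 = n by lia.
  have hf Psi i : (i < n.+2)%N -> height (face t0 Psi i) = i by apply: height_face.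
  have ne : face t0 Phi n != face t0 (fadj n t0 n.-1 Phi) n.
    rewrite eq_sym; apply/eqP; have := @face_fadj_neq _ _ _ polK t0 n.-1 Phi.
    by rewrite n1; apply.
  have fac Psi : facet n (face t0 Psi n) by apply/rank_height; rewrite hf.
  have nN : (n < n.+2)%N by lia.
  have n1N : (n.-1 < n.+2)%N by lia.
  have rH : rank (face t0 Phi n.-1) = (n%:Z - 2)%R.
    by have -> : (n%:Z - 2 = n.-1%:Z - 1)%R by [lia]; apply/rank_height; rewrite hf.
  have le Psi : face t0 Psi n.-1 <= face t0 Psi n by rewrite (face_le polK) // leq_pred.
  have := colP _ _ _ (fac _) (fac _) ne rH (le _).
  rewrite -{1}(@face_fadj _ _ _ polK t0 n.-1 Phi n.-1) //; last by rewrite ltn_eqF.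
  by move=> /(_ (le _)); case: (col _); case: (col _).
have [rho rhoP] := facet_reflections polK Phi0 n3 cS regF.
exists _, (faceM (polytopal_cover polK n3 s0 cS c_stab c0 colS rhoP)).
split; first split.
- exact: polytope_P.
- by move=> F; apply: facet_P.
- by split; [apply: chiral_P | apply: type_P].
Qed.
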